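(* Every non-degenerate $4$-oriented Spherical Diagram has at least six swirls and at least nine arcs; if it is moreover a Spherical Occlusion Diagram, it has at least ten arcs. These bounds are tight: there exist non-degenerate $4$-oriented SDs with exactly six swirls and nine arcs, and non-degenerate $4$-oriented SODs with exactly six swirls and ten arcs.
   Context: A geodesic arc on the unit sphere in $\mathbb R^3$ is the unique shortest curve joining two non-antipodal points. An arc $a$ blocks an arc $b$ (equivalently, $b$ hits $a$) if an endpoint of $b$ lies in the relative interior of $a$. A Spherical Diagram (SD) is a finite non-empty collection $\mathcal D$ of pairwise interior-disjoint geodesic arcs on the unit sphere such that each arc of $\mathcal D$ is blocked by arcs of $\mathcal D$ at each of its endpoints. A Spherical Occlusion Diagram (SOD) is an SD such that all arcs of $\mathcal D$ that hit the same arc of $\mathcal D$ reach it from the same side. A swirl of an SD is a cycle of arcs, each of which hits the next (and the last hits the first), going either all clockwise or all counterclockwise. An SD $\mathcal D$ is $k$-oriented if there exist a set $P$ of $k$ points on the unit sphere (poles), no two antipodal, and a function $f\colon\mathcal D\to P$ such that each arc $a\in\mathcal D$ lies on a great circle through $f(a)$ but contains neither $f(a)$ nor its antipode $-f(a)$. A $k$-oriented SD is degenerate if three of its $k$ poles lie on a common great circle, and non-degenerate otherwise. *)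

(* Defs.v *)
From mathcomp Require Import all_boot all_order all_algebra.
From mathcomp Require Import reals.
Set Implicit Arguments.
Unset Strict Implicit.
Unset Printing Implicit Defensive.
Import Order.TTheory GRing.Theory Num.Theory.
Local Open Scope ring_scope.

Section SphericalDiagrams.
Variable R : realType.

Definition vec := (R * R * R)%type.

Definition vx (u : vec) : R := u.1.1.
Definition vy (u : vec) : R := u.1.2.
Definition vz (u : vec) : R := u.2.

Definition dot (u v : vec) : R := vx u * vx v + vy u * vy v + vz u * vz v.
Definition vopp (u : vec) : vec := (- vx u, - vy u, - vz u).
Definition lin (s : R) (a : vec) (t : R) (b : vec) : vec :=
  (s * vx a + t * vx b, s * vy a + t * vy b, s * vz a + t * vz b).
Definition det3 (u v w : vec) : R :=
  vx u * (vy v * vz w - vz v * vy w)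
  - vy u * (vx v * vz w - vz v * vx w)
  + vz u * (vx v * vy w - vy v * vx w).

Definition on_sphere (p : vec) : Prop := dot p p = 1.

(* An arc is given by its two endpoints; it is the shortest geodesic between
   them, which requires distinct, non-antipodal unit vectors. *)
Definition sarc := (vec * vec)%type.

Definition is_arc (a : sarc) : Prop :=
  [/\ on_sphere a.1, on_sphere a.2, a.1 <> a.2 & a.1 <> vopp a.2].

Definition in_arc (p : vec) (a : sarc) : Prop :=
  on_sphere p /\ exists s t : R, [/\ 0 <= s, 0 <= t & p = lin s a.1 t a.2].

Definition in_relint (p : vec) (a : sarc) : Prop :=
  on_sphere p /\ exists s t : R, [/\ 0 < s, 0 < t & p = lin s a.1 t a.2].

Definition ends (a : sarc) (e f : vec) : Prop :=
  (e = a.1 /\ f = a.2) \/ (e = a.2 /\ f = a.1).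

Section Diagram.
Variables (I : finType) (D : I -> sarc).

Definition hits (i j : I) : Prop :=
  exists e f, ends (D i) e f /\ in_relint e (D j).

Definition SD : Prop :=
  [/\ (0 < #|I|)%N,
      (forall i, is_arc (D i)),
      (forall i j, i <> j -> forall p, in_relint p (D i) -> ~ in_relint p (D j))
    & (forall i, (exists j, in_relint (D i).1 (D j)) /\
                 (exists j, in_relint (D i).2 (D j)))].

(* all arcs hitting the same sarc D j reach it from the same side of the
   great circle of D j: the other endpoints lie on the same side *)
Definition same_side_hits : Prop :=
  forall i i' j e f e' f',
    ends (D i) e f -> in_relint e (D j) ->
    ends (D i') e' f' -> in_relint e' (D j) ->
    0 < det3 (D j).1 (D j).2 f * det3 (D j).1 (D j).2 f'.

Definition SOD : Prop := SD /\ same_side_hits.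

(* turn made when travelling along D x towards the point where it hits D y,
   then along D y towards the point where D y hits D z:
   the sign of det(f_x, e_x, e_y) (positive = counterclockwise) *)
Definition turn_pos (x y z : I) : Prop :=
  forall ex fx ey fy, ends (D x) ex fx -> in_relint ex (D y) ->
    ends (D y) ey fy -> in_relint ey (D z) -> 0 < det3 fx ex ey.
Definition turn_neg (x y z : I) : Prop :=
  forall ex fx ey fy, ends (D x) ex fx -> in_relint ex (D y) ->
    ends (D y) ey fy -> in_relint ey (D z) -> det3 fx ex ey < 0.

Definition swirl (s : seq I) : Prop :=
  [/\ (0 < size s)%N, uniq s,
      (forall x, x \in s -> hits x (next s x))
    & (forall x, x \in s -> turn_pos x (next s x) (next s (next s x))) \/
      (forall x, x \in s -> turn_neg x (next s x) (next s (next s x)))].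

Definition same_cycle (s t : seq I) : Prop := exists n, t = rot n s.

Definition distinct_swirls (ss : seq (seq I)) : Prop :=
  (forall s, s \in ss -> swirl s) /\
  (forall a b, (a < size ss)%N -> (b < size ss)%N -> a <> b ->
     ~ same_cycle (nth [::] ss a) (nth [::] ss b)).

Definition at_least_swirls (n : nat) : Prop :=
  exists ss, size ss = n /\ distinct_swirls ss.

Definition exactly_swirls (n : nat) : Prop :=
  exists ss, [/\ size ss = n, distinct_swirls ss &
     forall s, swirl s -> exists2 t, t \in ss & same_cycle t s].

Definition nondeg_oriented (k : nat) : Prop :=
  exists (P : 'I_k -> vec) (f : I -> 'I_k),
    [/\ (forall m, on_sphere (P m)),
        injective P,
        (forall m m', m <> m' -> P m <> vopp (P m')),
        (forall i, [/\ det3 (D i).1 (D i).2 (P (f i)) = 0,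
                       ~ in_arc (P (f i)) (D i)
                     & ~ in_arc (vopp (P (f i))) (D i)])
      & (forall m1 m2 m3, m1 <> m2 -> m1 <> m3 -> m2 <> m3 ->
           det3 (P m1) (P m2) (P m3) <> 0)].

End Diagram.
End SphericalDiagrams.

(* Main.v *)
Require Import Defs.
From Stdlib Require Import ZArith.
From mathcomp Require Import all_boot all_order all_algebra.
From mathcomp Require Import reals boolp ring lra zify ssrZ.

(* Rescale the poles so that they sum to zero and write points as x in R^4
   modulo (1,1,1,1); an arc of type i then moves the coordinate x_i only. For a
   pair T of types let F_T be the open cone x_k > x_l (k in T, l not in T):
   moving towards pole k in T, or away from pole l not in T, stays in F_T. These
   moves lead to a periodic orbit p -> C p with C > 1, which forces p in F_T and
   at least three types in the orbit. The six cones are disjoint, so there are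
   at least 18 arc ends, hence 9 arcs. With 9 arcs each cone carries one
   triangular swirl; one-sidedness makes the swirls at the two ends of an arc
   turn in opposite directions, and no such 2-colouring of the cones exists.

   For the swirls, follow an arc entering F_T and always turn left: the arcs
   already traversed bound a convex region, so the walk either closes up to a
   swirl or leaves F_T along an arc that enters F_T in the other direction. In
   the latter case the walk turning right from that arc encloses the first
   one; this can be repeated only finitely often. *)

Set Implicit Arguments.
Unset Strict Implicit.
Unset Printing Implicit Defensive.
Import Order.TTheory GRing.Theory Num.Theory.
Local Open Scope ring_scope.
Delimit Scope Z_scope with ZZ.

(** * Vectors, cones and Gram determinants *)

Section Vectors.
Variable R : realType.
Implicit Types (u v p q e f : vec R) (s t : R) (a : sarc R).

(** Points are handled as rays, so only their positive multiples matter; this is where the factor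
    [C] of a periodic orbit comes from. Such an orbit is a closed chain of arcs hitting one another,
    but its turns may be mixed: it bounds the number of ends from below without giving a swirl,
    which is why the walks are needed as well. Planar topology is avoided: a region is an
    intersection of half-spaces, and confinement is proved by following a segment to the first line
    that it meets and showing that the point reached lies on an arc of the walk, where disjointness
    applies. Two facts about blocking drive the rest: an arc is never coplanar with the arc that it
    hits, and a set of arcs closed under blocking cannot have all its ends in an open half-space,
    since an extreme end would be interior to another arc. *)

Definition linear_form (g : vec R -> R) : Prop :=
  forall s u t v, g (lin s u t v) = s * g u + t * g v.

(** The open cone over an arc. Unit length is dropped, so that points may be added and rescaled
    freely; [normalize] brings them back to the sphere. *)
Definition cone2 f e p : Prop :=
  exists s t, [/\ 0 < s, 0 < t & p = lin s f t e].

(** By Lagrange's identity this is the squared length of the cross product; it is positive exactly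
    when [u] and [v] are independent. *)
Definition gram u v : R := dot u u * dot v v - dot u v ^+ 2.

Ltac vring := rewrite /gram /det3 /dot /lin /vopp /vx /vy /vz /=; ring.

Lemma vec_eqP u v : vx u = vx v -> vy u = vy v -> vz u = vz v -> u = v.
Proof. by case: u => [[? ?] ?]; case: v => [[? ?] ?]; rewrite /vx /vy /vz /= => -> -> ->. Qed.

Lemma linC s u t v : lin s u t v = lin t v s u.
Proof. by apply: vec_eqP; vring. Qed.

Lemma det3_linear u v : linear_form (det3 u v).
Proof. by move=> s p t q; vring. Qed.

Lemma dot_linear u : linear_form (dot u).
Proof. by move=> s p t q; vring. Qed.

Lemma dot_linearl u s p t q : dot (lin s p t q) u = s * dot p u + t * dot q u.
Proof. by vring. Qed.

Lemma vx_linear : linear_form (@vx R). Proof. by []. Qed.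
Lemma vy_linear : linear_form (@vy R). Proof. by []. Qed.
Lemma vz_linear : linear_form (@vz R). Proof. by []. Qed.

Lemma linear_formN g : linear_form g -> linear_form (fun p => - g p).
Proof. by move=> hg s u t v; rewrite hg; ring. Qed.

Lemma linear_formZ c g : linear_form g -> linear_form (fun p => c * g p).
Proof. by move=> hg s u t v; rewrite hg; ring. Qed.

Lemma linear_formB g h :
  linear_form g -> linear_form h -> linear_form (fun p => g p - h p).
Proof. by move=> hg hh s u t v; rewrite hg hh; ring. Qed.

Lemma det3ee1 u v : det3 u v u = 0. Proof. by vring. Qed.
Lemma det3ee2 u v : det3 u v v = 0. Proof. by vring. Qed.
Lemma det3C12 u v p : det3 u v p = - det3 v u p. Proof. by vring. Qed.
Lemma det3rot u v p : det3 u v p = det3 v p u. Proof. by vring. Qed.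

Lemma gramC u v : gram u v = gram v u. Proof. by vring. Qed.

Lemma gram_lin s u t v s' t' :
  gram (lin s u t v) (lin s' u t' v) = (s * t' - t * s') ^+ 2 * gram u v.
Proof. by vring. Qed.

Lemma dot_ge0 u : 0 <= dot u u.
Proof. by rewrite /dot -!expr2 !addr_ge0 ?sqr_ge0. Qed.

Lemma dot_eq0 u : dot u u = 0 -> u = (0, 0, 0).
Proof.
rewrite /dot -!expr2 => /eqP.
rewrite paddr_eq0 ?addr_ge0 ?sqr_ge0 // paddr_eq0 ?sqr_ge0 // !sqrf_eq0.
by case/andP=> /andP[/eqP hx /eqP hy] /eqP hz; apply: vec_eqP.
Qed.

(** For unit vectors [gram] is a quarter of the product of the squared lengths of [a.1 - a.2] and
    [a.1 + a.2], which vanish only for equal or antipodal endpoints. *)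
Lemma gram_arc a : is_arc a -> 0 < gram a.1 a.2.
Proof.
case; rewrite /on_sphere => h1 h2 hne hno.
have hD : dot (lin 1 a.1 (-1) a.2) (lin 1 a.1 (-1) a.2) = 2 - 2 * dot a.1 a.2.
  by rewrite !(dot_linear, dot_linearl) h1 h2 (_ : dot a.2 a.1 = dot a.1 a.2);
    [ring | vring].
have hS : dot (lin 1 a.1 1 a.2) (lin 1 a.1 1 a.2) = 2 + 2 * dot a.1 a.2.
  by rewrite !(dot_linear, dot_linearl) h1 h2 (_ : dot a.2 a.1 = dot a.1 a.2);
    [ring | vring].
have nD : 0 < 2 - 2 * dot a.1 a.2.
  rewrite -hD lt_neqAle dot_ge0 andbT eq_sym; apply/eqP => /dot_eq0 h0.
  case: hne; have := (congr1 (@vx R) h0, congr1 (@vy R) h0, congr1 (@vz R) h0).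
  rewrite /lin /vx /vy /vz /= => -[[hx hy] hz].
  by apply: vec_eqP; rewrite /vx /vy /vz; lra.
have nS : 0 < 2 + 2 * dot a.1 a.2.
  rewrite -hS lt_neqAle dot_ge0 andbT eq_sym; apply/eqP => /dot_eq0 h0.
  case: hno; have := (congr1 (@vx R) h0, congr1 (@vy R) h0, congr1 (@vz R) h0).
  rewrite /lin /vx /vy /vz /= => -[[hx hy] hz].
  by apply: vec_eqP; rewrite /vopp /vx /vy /vz /=; lra.
rewrite /gram h1 h2; nra.
Qed.

Lemma det3_span f e p : 0 < gram f e -> det3 f e p = 0 ->
  exists s t, p = lin s f t e.
Proof.
move=> g0 d0; have gn0 : gram f e != 0 by rewrite gt_eqF.
exists ((dot p f * dot e e - dot p e * dot f e) / gram f e),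
       ((dot p e * dot f f - dot p f * dot f e) / gram f e).
(* Up to the factor [gram f e], these are the coordinates of [p] in the basis made of [f], [e] and
   their cross product. *)
have hx : gram f e * vx p = (dot p f * dot e e - dot p e * dot f e) * vx f
   + (dot p e * dot f f - dot p f * dot f e) * vx e
   + det3 f e p * (vy f * vz e - vz f * vy e) by vring.
have hy : gram f e * vy p = (dot p f * dot e e - dot p e * dot f e) * vy f
   + (dot p e * dot f f - dot p f * dot f e) * vy e
   + det3 f e p * (vz f * vx e - vx f * vz e) by vring.
have hz : gram f e * vz p = (dot p f * dot e e - dot p e * dot f e) * vz f
   + (dot p e * dot f f - dot p f * dot f e) * vz e
   + det3 f e p * (vx f * vy e - vy f * vx e) by vring.
rewrite d0 !mul0r !addr0 in hx hy hz.
by apply: vec_eqP; apply: (mulfI gn0);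
  rewrite ?hx ?hy ?hz; move: gn0; generalize (gram f e) => g gn0;
  rewrite /lin /vx /vy /vz /=; field.
Qed.

Lemma lin_inj f e s t s' t' : 0 < gram f e ->
  lin s f t e = lin s' f t' e -> s = s' /\ t = t'.
Proof.
move=> g0 h; have gn0 : gram f e != 0 by rewrite gt_eqF.
have hf := congr1 (dot f) h; have he := congr1 (dot e) h.
rewrite !dot_linear in hf he.
have E : dot e f = dot f e by vring.
rewrite E in he.
have h1 : (s - s') * gram f e = 0.
  transitivity ((s * dot f f + t * dot f e - (s' * dot f f + t' * dot f e)) * dot e e
    - (s * dot f e + t * dot e e - (s' * dot f e + t' * dot e e)) * dot f e).
    by rewrite /gram; ring.
  by rewrite hf he !subrr !mul0r subrr.
have h2 : (t - t') * gram f e = 0.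
  transitivity ((s * dot f e + t * dot e e - (s' * dot f e + t' * dot e e)) * dot f f
    - (s * dot f f + t * dot f e - (s' * dot f f + t' * dot f e)) * dot f e).
    by rewrite /gram; ring.
  by rewrite hf he !subrr !mul0r subrr.
move/eqP: h1; rewrite mulf_eq0 (negbTE gn0) orbF subr_eq0 => /eqP ->.
by move/eqP: h2; rewrite mulf_eq0 (negbTE gn0) orbF subr_eq0 => /eqP ->.
Qed.

Lemma cone2C f e p : cone2 f e p -> cone2 e f p.
Proof. by case=> s [t [s0 t0 ->]]; exists t, s; rewrite linC. Qed.

Lemma lin_lin f e s t (a1 b1 a2 b2 : R) :
  lin s (lin a1 f b1 e) t (lin a2 f b2 e) = lin (s * a1 + t * a2) f (s * b1 + t * b2) e.
Proof. by apply: vec_eqP; vring. Qed.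

Lemma lin01 f e : lin 0 f 1 e = e. Proof. by apply: vec_eqP; vring. Qed.

(* Cramer's rule for the covector [u]. *)
Lemma det3_dot0 u p q e : dot u p = 0 -> dot u q = 0 -> dot u e = 0 ->
  det3 p q e != 0 -> u = (0, 0, 0).
Proof.
move=> hp hq he hd.
have hx : det3 p q e * vx u = dot u p * (vy q * vz e - vz q * vy e)
  + dot u q * (vy e * vz p - vz e * vy p) + dot u e * (vy p * vz q - vz p * vy q) by vring.
have hy : det3 p q e * vy u = dot u p * (vz q * vx e - vx q * vz e)
  + dot u q * (vz e * vx p - vx e * vz p) + dot u e * (vz p * vx q - vx p * vz q) by vring.
have hz : det3 p q e * vz u = dot u p * (vx q * vy e - vy q * vx e)
  + dot u q * (vx e * vy p - vy e * vx p) + dot u e * (vx p * vy q - vy p * vx q) by vring.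
rewrite hp hq he !mul0r !addr0 in hx hy hz.
by apply: vec_eqP; apply: (mulfI hd); rewrite ?hx ?hy ?hz mulr0.
Qed.

Definition normalize u : vec R := lin (Num.sqrt (dot u u))^-1 u 0 u.

Lemma normalize_sphere u : 0 < dot u u -> on_sphere (normalize u).
Proof.
move=> u0; rewrite /on_sphere /normalize dot_linear !dot_linearl !mul0r !addr0.
rewrite mulrA -expr2 exprVn sqr_sqrtr ?(ltW u0) // mulVf ?gt_eqF //.
Qed.

Lemma in_relint_normalize u a : 0 < dot u u -> cone2 a.1 a.2 u ->
  in_relint (normalize u) a.
Proof.
move=> u0 [s [t [s0 t0 hu]]]; split; first exact: normalize_sphere.
have k0 : 0 < (Num.sqrt (dot u u))^-1 by rewrite invr_gt0 sqrtr_gt0.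
exists ((Num.sqrt (dot u u))^-1 * s), ((Num.sqrt (dot u u))^-1 * t).
split; [exact: mulr_gt0|exact: mulr_gt0|].
by rewrite /normalize {2}hu; apply: vec_eqP; rewrite hu; vring.
Qed.

End Vectors.

(** * Pigeonhole and finite families of real functions *)

Lemma first_repeat (T : finType) (y : nat -> T) :
  exists s t, [/\ (s < t)%N, y s = y t
    & forall i j, (i < t)%N -> (j < t)%N -> y i = y j -> i = j].
Proof.
pose P t := ~~ uniq (mkseq y t.+1).
have exP : exists t, P t.
  exists #|T|; apply/negP => /card_uniqP h.
  have := max_card (mem (mkseq y #|T|.+1)).
  by rewrite h size_mkseq ltnn.
have [t Pt tmin] := ex_minnP exP.
have ut : uniq (mkseq y t).
  case: t Pt tmin => [//|t] Pt tmin.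
  by apply/negPn/negP => h; have := tmin t h; rewrite ltnn.
have inj i j : (i < t)%N -> (j < t)%N -> y i = y j -> i = j.
  move=> it jt hij; have := @nth_uniq _ (y 0%N) (mkseq y t) i j.
  by rewrite size_mkseq => /(_ it jt ut); rewrite !nth_mkseq // hij eqxx => /esym/eqP.
have yt : y t \in mkseq y t.
  move: Pt; rewrite /P /mkseq -addn1 iotaD add0n map_cat cat_uniq /= orbF andbT.
  by rewrite -/(mkseq y t) ut /= negbK.
case/mapP: yt => s; rewrite mem_iota add0n => /andP[_ st] hst.
by exists s, t; split.
Qed.

Section RealFamilies.
Variable R : realType.

Lemma wmean_gt0 (s t x y : R) :
  0 <= s -> 0 <= t -> 0 < s + t -> 0 < x -> 0 < y -> 0 < s * x + t * y.
Proof.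
rewrite le_eqVlt => /predU1P[<-|s0] t0 st x0 y0.
  by rewrite mul0r add0r mulr_gt0 //; move: st; rewrite add0r.
by apply: ltr_pwDl; [apply: mulr_gt0|apply: mulr_ge0 => //; apply: ltW].
Qed.

(** Used to stay near a ray: for large [N] the vector [N p + q] points almost along [p], so finitely
    many strict inequalities that hold at [p] hold there too. *)
Lemma large_multiple (T : finType) (P : pred T) (a b : T -> R) :
  (forall t, P t -> 0 < a t) ->
  exists2 N0, 0 < N0 & forall N, N0 <= N -> forall t, P t -> 0 < N * a t + b t.
Proof.
move=> a0; pose S := \sum_(t | P t) `|b t| / a t.
have S0 : 0 <= S by apply: sumr_ge0 => t Pt; rewrite divr_ge0 ?normr_ge0 // ltW // a0.
exists (S + 1); first by lra.
move=> N hN t Pt.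
have hS : `|b t| / a t <= S.
  rewrite /S (bigD1 t) //= lerDl; apply: sumr_ge0 => u /andP[Pu _].
  by rewrite divr_ge0 ?normr_ge0 // ltW // a0.
have hb : `|b t| <= S * a t by rewrite -ler_pdivrMr ?a0.
have := ler_norm (- b t); rewrite normrN => hn.
have := a0 t Pt; nra.
Qed.

(** [a] and [b] are the values of finitely many affine functions at the two ends of a segment, and
    [h] is a time at which all are still nonnegative and one vanishes. Induction on their number: if
    the new function is already negative at the time found for the others, that time is shortened by
    the factor [k]. *)
Lemma first_exit n (a b : nat -> R) :
  (forall s, (s < n)%N -> 0 <= a s) ->
  (exists2 s, (s < n)%N & b s <= 0) ->
  exists2 h, 0 <= h <= 1 &
    (forall s, (s < n)%N -> 0 <= (1 - h) * a s + h * b s) /\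
    (exists2 s, (s < n)%N & (1 - h) * a s + h * b s = 0).
Proof.
move=> a0 [s0 s0n bs0].
(* The value [h = 1] is the default when no function has vanished so far; it starts the induction at
   [n = 0]. *)
suff [h h01 [hv [h1|hz]]] : exists2 h, 0 <= h <= 1 &
    (forall s, (s < n)%N -> 0 <= (1 - h) * a s + h * b s) /\
    (h = 1 \/ (exists2 s, (s < n)%N & (1 - h) * a s + h * b s = 0)).
- exists h => //; split=> //; exists s0 => //.
  by have := hv s0 s0n; rewrite h1; nra.
- by exists h.
clear s0 s0n bs0; elim: n a0 => [|n IH] a0.
  by exists 1; rewrite ?ler01 ?lexx //; split=> //; left.
have [s sn|h /andP[h0 h1] [hv hz]] := IH; first by apply: a0; rewrite ltnS ltnW.
have [vn|vn] := leP 0 ((1 - h) * a n + h * b n).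
  exists h; first by rewrite h0.
  split=> [s|]; first by rewrite ltnS leq_eqVlt => /predU1P[->|/hv].
  case: hz => [->|[s sn hs]]; [by left|right; exists s => //; exact: ltnW].
have an := a0 n (ltnSn n).
set v := (1 - h) * a n + h * b n in vn *.
have dpos : 0 < a n - v by lra.
pose k := a n / (a n - v).
have k0 : 0 <= k by rewrite divr_ge0 // ltW.
have k1 : k <= 1 by rewrite ler_pdivrMr // mul1r; lra.
have kE : k * (a n - v) = a n by rewrite divfK // gt_eqF.
exists (h * k); first by rewrite mulr_ge0 //= mulr_ile1.
have E c d : (1 - h * k) * c + h * k * d = (1 - k) * c + k * ((1 - h) * c + h * d).
  by ring.
have zn : (1 - h * k) * a n + h * k * b n = 0 by rewrite E -/v; nra.
split; last by right; exists n.
move=> s; rewrite ltnS leq_eqVlt => /predU1P[->|sn]; first by rewrite zn.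
have h2 := hv s sn; have h3 := a0 s (leqW sn).
rewrite E; apply: addr_ge0; apply: mulr_ge0 => //; lra.
Qed.

End RealFamilies.

(** * Walks and trapped swirls *)

Section Diagram.
Variables (R : realType) (I : finType).
Variables (ep : I -> bool -> vec R) (nxt : I -> bool -> I).

Definition on_arc a p := cone2 (ep a false) (ep a true) p.

Hypothesis gramP : forall a, 0 < gram (ep a false) (ep a true).
Hypothesis hitP : forall a b, on_arc (nxt a b) (ep a b).
Hypothesis disjP : forall a a' p, on_arc a p -> on_arc a' p -> a = a'.

Lemma gram_ep a b : 0 < gram (ep a (~~ b)) (ep a b).
Proof. by case: b => /=; [|rewrite gramC]; apply: gramP. Qed.

Lemma on_arc_ends a b p : on_arc a p <-> cone2 (ep a (~~ b)) (ep a b) p.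
Proof. by case: b; split=> // /cone2C. Qed.

Lemma on_arc_scale a p c d q : on_arc a p -> 0 < c -> d = 0 -> on_arc a (lin c p d q).
Proof.
case=> s [t [s0 t0 ->]] c0 ->; exists (c * s), (c * t).
by split; rewrite ?mulr_gt0 //; apply: vec_eqP; rewrite /lin /vx /vy /vz /=; ring.
Qed.

Lemma on_arc_conv a p q s t : on_arc a p -> on_arc a q -> 0 <= s -> 0 <= t -> 0 < s + t ->
  on_arc a (lin s p t q).
Proof.
case=> s1 [t1 [s10 t10 ->]] [s2 [t2 [s20 t20 ->]]] s0 t0 st0.
by rewrite lin_lin; exists (s * s1 + t * s2), (s * t1 + t * t2); split=> //; apply: wmean_gt0.
Qed.

Lemma on_arc_near a b p s t : 0 < s -> 0 < t ->
  p = lin s (ep a b) t (ep a (~~ b)) -> on_arc a p.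
Proof. by move=> s0 t0 ->; apply/(on_arc_ends a b); exists t, s; rewrite linC. Qed.

Lemma on_arc_near_end a p b s t : on_arc a p -> 0 < s -> 0 <= t ->
  on_arc a (lin s p t (ep a b)).
Proof.
move=> /(on_arc_ends a b) [s1 [t1 [s10 t10 ->]]] s0 t0.
apply/(on_arc_ends a b); exists (s * s1), (s * t1 + t); split; [nra|nra|].
by apply: vec_eqP; rewrite /lin /vx /vy /vz /=; ring.
Qed.

Lemma end_notin_arc a b : ~ on_arc a (ep a b).
Proof.
move/(on_arc_ends a b) => [s [t [s0 t0]]]; rewrite -{1}(lin01 (ep a (~~ b)) (ep a b)).
by case/(lin_inj (gram_ep a b)) => h _; move: s0; rewrite -h ltxx.
Qed.

Lemma nxt_neq a b : nxt a b <> a.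
Proof. by move=> h; have := hitP a b; rewrite h; apply: end_notin_arc. Qed.

(** If the other end of [a] were coplanar with the arc that blocks [ep a b], points of [a] close to
    [ep a b] would be interior to that arc as well, against disjointness. *)
Lemma transversal a b b' :
  det3 (ep (nxt a b) (~~ b')) (ep (nxt a b) b') (ep a (~~ b)) != 0.
Proof.
apply/eqP => /(det3_span (gram_ep _ _)) [s [t hf]].
have /(on_arc_ends _ b') [s0 [t0 [s00 t00 he]]] := hitP a b.
have [N N0 hN] := @large_multiple R bool predT (fun c => if c then s0 else t0)
  (fun c => if c then s else t) ltac:(by case).
have hs := hN N (lexx N) true isT; have ht := hN N (lexx N) false isT.
apply: (@nxt_neq a b).
apply: (@disjP _ _ (lin N (ep a b) 1 (ep a (~~ b)))).
  by apply/(on_arc_ends _ b'); rewrite hf he lin_lin !mul1r; exists (N * s0 + s), (N * t0 + t).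
exact: (on_arc_near (b := b) N0 ltr01).
Qed.

Implicit Types (x : I * bool) (sg : bool).

(* A state [(a, b)] is the arc [a] travelled towards its end [ep a b]; [step]
   turns left at the arc hit there, or right when [sg] is set. *)
Definition front x := ep x.1 x.2.
Definition back x := ep x.1 (~~ x.2).
Definition side sg x p : R := (-1) ^+ sg * det3 (back x) (front x) p.
Definition step sg x : I * bool :=
  (nxt x.1 x.2, 0 < side sg x (ep (nxt x.1 x.2) true)).
Definition reverse x : I * bool := (x.1, ~~ x.2).

Lemma side_linear sg x : linear_form (side sg x).
Proof. exact/linear_formZ/det3_linear. Qed.

Lemma side_reverse sg x p : side sg (reverse x) p = - side sg x p.
Proof. by rewrite /side /back /front /= negbK det3C12 mulrN. Qed.

(** Reversing the travel and exchanging left and right cancel out; so a restarted walk begins with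
    the half-space with which the previous walk ended. *)
Lemma side_reverseN sg x p : side (~~ sg) (reverse x) p = side sg x p.
Proof. by rewrite side_reverse /side signrN mulNr opprK. Qed.

Lemma side_front sg x : side sg x (front x) = 0.
Proof. by rewrite /side det3ee2 mulr0. Qed.

Lemma side_back sg x : side sg x (back x) = 0.
Proof. by rewrite /side det3ee1 mulr0. Qed.

Lemma side_on_arc sg x p : on_arc x.1 p -> side sg x p = 0.
Proof.
by case/(on_arc_ends _ x.2) => s [t [_ _ ->]]; rewrite side_linear side_front side_back !mulr0 addr0.
Qed.

Lemma side_eq0 sg x p : side sg x p = 0 -> exists s t, p = lin s (back x) t (front x).
Proof.
by move/eqP; rewrite mulf_eq0 signr_eq0 => /eqP/(det3_span (gram_ep _ _)).
Qed.

Lemma hit_state x x' : x'.1 = nxt x.1 x.2 ->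
  exists s t, [/\ 0 < s, 0 < t & front x = lin s (back x') t (front x')].
Proof. by move=> h; apply/(on_arc_ends _ x'.2); rewrite h; apply: hitP. Qed.

Lemma side_hit sg x x' : x'.1 = nxt x.1 x.2 -> side sg x' (back x) != 0.
Proof.
by move=> h; rewrite /side mulf_neq0 ?signr_eq0 // /back /front h transversal.
Qed.

Lemma side_turn sg x x' : x'.1 = nxt x.1 x.2 ->
  exists2 c, 0 < c & side sg x (front x') = c * side sg x' (back x).
Proof.
case/hit_state => s [t [s0 t0 he]]; exists s => //.
rewrite /side he; move: (back x) (back x') (front x') => u v w.
by rewrite /det3 /lin /vx /vy /vz /=; ring.
Qed.

Lemma step1 sg x : (step sg x).1 = nxt x.1 x.2. Proof. by []. Qed.

(** The hit point has side 0 and is interior to the hit arc, whose ends therefore lie on opposite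
    sides; [step] picks the positive one. *)
Lemma side_step_front sg x : 0 < side sg x (front (step sg x)).
Proof.
have hx : (nxt x.1 x.2, true).1 = nxt x.1 x.2 by [].
have [s [t [s0 t0 he]]] := hit_state hx.
have := side_front sg x; rewrite {1}he side_linear => h0.
have [c c0 hc] := side_turn sg hx.
have hne : side sg x (front (nxt x.1 x.2, true)) != 0.
  by rewrite hc; apply: mulf_neq0; [exact: lt0r_neq0|exact: side_hit].
rewrite /step /front /=; case hb: (0 < side sg x (ep (nxt x.1 x.2) true)); first exact: hb.
move/negbT: hb; rewrite -leNgt le_eqVlt (negbTE hne) /= => hlt.
have : 0 < s * side sg x (back (nxt x.1 x.2, true)).
  by move: hlt; rewrite /front /= => hlt; move: h0; rewrite /front /=; nra.
by rewrite pmulr_rgt0.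
Qed.

Lemma side_step_back sg x : 0 < side sg (step sg x) (back x).
Proof.
have [c c0 hc] := side_turn sg (step1 sg x).
by have := side_step_front sg x; rewrite hc pmulr_rgt0.
Qed.

(** * Walks inside an open convex trap *)

Section Trap.
Variables (T : finType) (Q : pred T) (phi : T -> vec R -> R).
Hypothesis Q0 : exists t, Q t.
Hypothesis phi_linear : forall t, linear_form (phi t).

Definition trap p := forall t, Q t -> 0 < phi t p.

(** For a face this is the end reached by an allowed move. It makes the arc along which a walk
    leaves the trap an entering arc when reversed. *)
Hypothesis trapP : forall a p, on_arc a p -> trap p -> exists b, trap (ep a b).

Lemma trap_lin s p t q : trap p -> trap q -> 0 <= s -> 0 <= t -> 0 < s + t ->
  trap (lin s p t q).
Proof.
move=> hp hq s0 t0 st u Qu; rewrite phi_linear.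
by apply: wmean_gt0 => //; [apply: hp|apply: hq].
Qed.

Lemma trap_near p q : trap p ->
  exists2 N0, 0 < N0 & forall N, N0 <= N -> trap (lin N p 1 q).
Proof.
move=> hp; have [N0 N00 hN] := @large_multiple R T Q (phi ^~ p) (phi ^~ q) hp.
by exists N0 => // N /hN h u Qu; rewrite phi_linear mul1r h.
Qed.

Definition entering x := ~ trap (back x) /\ trap (front x).

(* In the half-planes of the neighbouring states of a walk, the part inside
   the trap of the line through [y s] is covered by arcs of the walk. *)
Section Barrier.
Variables (sg : bool) (y : nat -> I * bool).
Hypothesis ystep : forall t, y t.+1 = step sg (y t).

Lemma walk_hit t : on_arc (y t.+1).1 (front (y t)).
Proof. by rewrite ystep; apply: hitP. Qed.

Lemma walk_hit_state t :
  exists u v, [/\ 0 < u, 0 < v & front (y t) = lin u (back (y t.+1)) v (front (y t.+1))].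
Proof. by apply: hit_state; rewrite ystep. Qed.

(** Cuts off the part of the line of [y s] before the back end: for [s > 0] by the half-space of the
    previous state, at the start because the back end is outside the convex trap. *)
Definition behind s p :=
  if s is s'.+1 then 0 <= side sg (y s') p else entering (y 0).

Lemma behind_coef s p a b : trap p -> p = lin a (back (y s)) b (front (y s)) ->
  behind s p -> 0 <= a -> 0 <= b /\ (0 < a -> 0 < b).
Proof.
move=> Fp hp hb a0; case: s hp hb => [|s] hp /=.
  move=> [nF FE]; suff b0 : 0 < b by rewrite (ltW b0).
  rewrite ltNge; apply/negP => b0; apply: nF => t Qt.
  have := Fp t Qt; rewrite hp phi_linear => h; have := FE t Qt => h2.
  have h3 : 0 < a * phi t (back (y 0%N)) by nra.
  by move: h3; rewrite pmulr_rgt0 // lt_neqAle a0 andbT; apply/eqP => a00;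
    move: h; rewrite -a00; nra.
have [u [v [u0 v0 he]]] := walk_hit_state s.
have := side_front sg (y s); rewrite he side_linear => h0.
have := side_step_front sg (y s); rewrite -ystep => hE.
rewrite hp side_linear => hb.
set f := side sg (y s) (back _) in h0 hb; set e := side sg (y s) _ in h0 hE hb.
have h1 : 0 <= (b * u - a * v) * e by nra.
have h2 : 0 <= b * u - a * v by rewrite -(pmulr_lge0 _ hE).
split.
  by rewrite -(pmulr_lge0 _ u0); nra.
by move=> a1; rewrite -(pmulr_lgt0 _ u0); nra.
Qed.

(** On the line of [y s], the half-space of [y s.+1] cuts off what lies beyond the front end, and
    [behind] what lies before the back end. The front end itself belongs to the next arc. *)
Lemma barrier s p : trap p -> side sg (y s) p = 0 -> behind s p ->
  0 <= side sg (y s.+1) p -> on_arc (y s).1 p \/ on_arc (y s.+1).1 p.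
Proof.
move=> Fp /side_eq0 [a [b hp]] hb.
have := side_step_back sg (y s); rewrite -ystep => hf.
have := side_on_arc sg (walk_hit s) => he.
rewrite hp side_linear he mulr0 addr0 (pmulr_lge0 _ hf) => a0.
have [b0 b1] := behind_coef Fp hp hb a0.
move: a0; rewrite le_eqVlt => /predU1P[a0|a0]; last first.
  by left; rewrite -hp; apply/(on_arc_ends _ (y s).2); exists a, b; split=> //; apply: b1.
right; rewrite -a0 linC; apply: on_arc_scale => //; first exact: walk_hit.
rewrite lt_neqAle b0 andbT; apply/eqP => bb.
by case: Q0 => t /Fp; rewrite hp phi_linear -a0 -bb !mul0r addr0 ltxx.
Qed.

(** For the arc that leaves the trap, convexity replaces the next half-space: a point of the trap at
    or beyond the front end would put that end in the trap as well, together with the hit point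
    [front (y s)]. *)
Lemma barrier_exit s p : trap p -> side sg (y s.+1) p = 0 -> behind s.+1 p ->
  trap (front (y s)) -> ~ trap (front (y s.+1)) -> on_arc (y s.+1).1 p.
Proof.
move=> Fp /side_eq0 [a [b hp]] hb Fs nF.
have [a0|a0] := ltP 0 a.
  have [b0 b1] := behind_coef Fp hp hb (ltW a0).
  by rewrite hp; apply/(on_arc_ends _ (y s.+1).2); exists a, b; split=> //; apply: b1.
case: nF => t Qt.
have [u [v [u0 v0 he]]] := walk_hit_state s.
have := side_front sg (y s); rewrite he side_linear => h0.
have := side_step_front sg (y s); rewrite -ystep => hE.
move: hb; rewrite /= hp side_linear => hb.
set f := side sg (y s) (back _) in h0 hb; set e := side sg (y s) _ in h0 hE hb.
have h1 : 0 <= (b * u - a * v) * e by nra.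
have h2 : 0 <= b * u - a * v by rewrite -(pmulr_lge0 _ hE).
have := Fp t Qt; rewrite hp phi_linear => h3.
have := Fs t Qt; rewrite he phi_linear => h4.
set F1 := phi t (back _) in h3 h4; set F2 := phi t _ in h3 h4 *.
have h5 : 0 < (b * u - a * v) * F2 by nra.
have h6 : 0 < b * u - a * v.
  by rewrite lt_neqAle h2 andbT; apply/eqP => z; move: h5; rewrite -z mul0r ltxx.
by rewrite -(pmulr_rgt0 _ h6).
Qed.

(** If the piece of arc from [front (y t)] to [front (y t.+1)] crossed the line of an earlier state,
    the first crossing would lie on an earlier arc by [barrier], while it also lies on the arc of
    [y t.+1]. *)
Lemma walk_inside t : entering (y 0) ->
  (forall i j, (i <= t)%N -> (j <= t)%N -> (y i).1 = (y j).1 -> i = j) ->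
  (forall i, (i <= t)%N -> trap (front (y i))) ->
  forall s, (s <= t)%N -> 0 <= side sg (y s) (front (y t)).
Proof.
move=> y0; elim: t => [|t IH] inj Ft s; first by rewrite leqn0 => /eqP ->; rewrite side_front.
have {}IH : forall s, (s <= t)%N -> 0 <= side sg (y s) (front (y t)).
  by apply: IH => [i j it jt|i it]; [apply: inj; apply: leqW|apply/Ft/leqW].
rewrite leq_eqVlt => /predU1P[->|]; first by rewrite side_front.
rewrite ltnS leq_eqVlt => /predU1P[->|st].
  by apply: ltW; rewrite ystep; apply: side_step_front.
rewrite leNgt; apply/negP => hs.
have [i it||h /andP[h0 h1] [hv [k kt hk]]] :=
  @first_exit R t (fun i => side sg (y i) (front (y t))) (fun i => side sg (y i) (front (y t.+1))).
- exact/IH/ltnW.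
- by exists s => //; apply: ltW.
have hlt : h < 1.
  rewrite lt_neqAle h1 andbT; apply/eqP => h11.
  by have := hv s st; rewrite h11; lra.
pose p := lin (1 - h) (front (y t)) h (front (y t.+1)).
have hp i : side sg (y i) p = (1 - h) * side sg (y i) (front (y t)) + h * side sg (y i) (front (y t.+1)).
  by rewrite /p side_linear.
have Fp : trap p by apply: trap_lin; rewrite ?subr_ge0 // ?subrK // ; apply: Ft.
have relp : on_arc (y t.+1).1 p.
  by apply: on_arc_near_end => //; [apply: walk_hit|rewrite subr_gt0].
have ge i : (i <= t)%N -> 0 <= side sg (y i) p.
  rewrite leq_eqVlt => /predU1P[->|/hv]; last by rewrite hp.
  rewrite hp side_front mulr0 add0r mulr_ge0 // ystep; exact/ltW/side_step_front.
have bk : behind k p.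
  by case: k kt {hk} => //= k kt; apply: ge; apply: ltnW; apply: ltnW.
rewrite -hp in hk.
case: (barrier Fp hk bk (ge _ kt)) => hr.
  by have := inj _ _ (leqnn _) _ (disjP relp hr); lia.
by have := inj _ _ (leqnn _) _ (disjP relp hr); lia.
Qed.

End Barrier.

Definition walk sg x t := iter t (step sg) x.

Lemma walkS sg x t : walk sg x t.+1 = step sg (walk sg x t). Proof. by []. Qed.

Definition trapped_swirl sg x n : Prop :=
  [/\ (0 < n)%N, walk sg x n = x,
      (forall i j, (i < n)%N -> (j < n)%N ->
         (walk sg x i).1 = (walk sg x j).1 -> i = j)
    & forall i, (i < n)%N -> trap (front (walk sg x i))].

Definition exit_chain sg x m : Prop :=
  [/\ entering x,
      (forall i j, (i <= m)%N -> (j <= m)%N ->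
         (walk sg x i).1 = (walk sg x j).1 -> i = j),
      (forall i, (i < m)%N -> trap (front (walk sg x i)))
    & ~ trap (front (walk sg x m))].

(** If all fronts before the first repeated arc are in the trap, this arc closes the walk. It cannot
    be met again in the opposite direction, because the walk would then reach it from the negative
    side of the earlier state, against [walk_inside]. *)
Lemma swirl_or_exit sg x : entering x ->
  (exists x' n, trapped_swirl sg x' n) \/ (exists m, exit_chain sg x m).
Proof.
move=> hx; pose y := walk sg x; have ystep := walkS sg x.
have [s [t [st hst inj]]] := first_repeat (fun i => (y i).1).
have [|Fall] := pselect (exists i, (i < t)%N && `[< ~ trap (front (y i)) >]).
  move=> /ex_minnP [m /andP[mt /asboolP nF] mmin]; right; exists m; split=> //.
    by move=> i j im jm; apply: inj; apply: leq_ltn_trans mt.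
  move=> i im; apply: contrapT => nFi.
  have /mmin : (i < t)%N && `[< ~ trap (front (y i)) >].
    by rewrite (ltn_trans im mt); apply/asboolP.
  by rewrite leqNgt im.
have Ft i : (i < t)%N -> trap (front (y i)).
  move=> it; apply: contrapT => nF; apply: Fall; exists i; rewrite it.
  exact/asboolP.
left; have yst : y t = y s.
  case: (ltngtP s.+1 t) st => // [st _|st _]; last first.
    by move: hst; rewrite -st /y walkS step1 => /esym/(@nxt_neq _ _).
  case: t st hst inj {Fall} Ft => [|[|t]] // st hst inj Ft.
  case ht : (y t.+2) (hst) => [a b] /= hsa; case hs : (y s) hsa => [a' b'] /= ea; subst a'.
  have [->//|bb] := eqVneq b b'.
  have hrev : y t.+2 = reverse (y s).
    by rewrite ht hs /reverse /=; case: (b) (b') bb => [] [].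
  have h1 := side_step_back sg (y t.+1); rewrite -ystep -/(y _) hrev side_reverse oppr_gt0 in h1.
  have h2 : side sg (y s) (front (y t.+1)) = 0.
    by apply: side_on_arc; rewrite hst; apply: walk_hit.
  have [u [v [u0 v0 he]]] := walk_hit_state ystep t.
  have : 0 <= side sg (y s) (front (y t)).
    apply: (walk_inside ystep) => //.
    - by move=> i j it jt; apply: inj; lia.
    - by move=> i it; apply: Ft; lia.
  by rewrite /y he side_linear -/(y _) h2 mulr0 addr0 pmulr_rge0 // leNgt h1.
have E' i : walk sg (y s) i = y (i + s)%N by rewrite /walk /y /walk iterD.
exists (y s), (t - s)%N; split.
- by rewrite subn_gt0.
- by rewrite E' subnK // ltnW.
- move=> i j it jt; rewrite !E' => /inj h.
  by have := h _ _; lia.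
- by move=> i it; rewrite E'; apply: Ft; lia.
Qed.

(** * Walks that leave the trap, and the region they bound *)

Section ExitChain.
Variables (sg : bool) (x : I * bool) (m : nat).
Hypothesis ch : exit_chain sg x m.
Local Notation y := (walk sg x).
Let ystep : forall t, y t.+1 = step sg (y t) := walkS sg x.

Let y0 : entering (y 0%N). Proof. by case: ch. Qed.
Let inj i j : (i <= m)%N -> (j <= m)%N -> (y i).1 = (y j).1 -> i = j.
Proof. by case: ch => _ h _ _; apply: h. Qed.
Let Ft i : (i < m)%N -> trap (front (y i)).
Proof. by case: ch => _ _ h _; apply: h. Qed.
Let nF : ~ trap (front (y m)).
Proof. by case: ch. Qed.

Lemma exit_chain_gt0 : (0 < m)%N.
Proof. by case: posnP nF => // ->; case: y0. Qed.

Lemma chain_barrier s p : (s <= m)%N -> trap p -> side sg (y s) p = 0 ->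
  (forall s', s = s'.+1 -> 0 <= side sg (y s') p) ->
  ((s < m)%N -> 0 <= side sg (y s.+1) p) ->
  exists k, [/\ (s <= k <= s.+1)%N, (k <= m)%N & on_arc (y k).1 p].
Proof.
move=> sm Fp hs hb hf.
have bk : behind sg y s p by case: s hb {sm hs hf} => //= s; apply.
move: sm; rewrite leq_eqVlt => /predU1P[sm|sm]; last first.
  by case: (barrier ystep Fp hs bk (hf sm)) => h; [exists s|exists s.+1]; split=> //; lia.
exists s; split; rewrite ?leqnn ?leqnSn ?sm //.
case: m exit_chain_gt0 Ft nF sm => // m' _ Fm nFm sm; subst s.
by apply: (barrier_exit ystep) => //; apply: Fm.
Qed.

Lemma chain_inside s t : (s <= t)%N -> (t < m)%N -> 0 <= side sg (y s) (front (y t)).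
Proof.
move=> st tm; apply: (walk_inside ystep) => //.
  by move=> i j it jt; apply: inj; lia.
by move=> i it; apply: Ft; lia.
Qed.

(** Counterpart of [chain_inside] for later states, valid for all points of an earlier arc in the
    trap. Downward induction on [t]: [front (y t)] is a point of the next arc, and a first crossing
    met from there along the arc of [y t] would lie on an arc [y k] with [k > t + 1]. *)
Lemma chain_outside s t p : on_arc (y t).1 p -> trap p -> (t < s <= m)%N ->
  0 <= side sg (y s) p.
Proof.
move=> hr Fp /andP[ts sm].
have [k hk] : exists k, (t + k = m)%N by exists (m - t)%N; lia.
elim: k t hk s p ts sm hr Fp => [|k IH] t hk s p ts sm hr Fp; first lia.
have Et i : (t < i)%N -> (i <= m)%N -> 0 <= side sg (y i) (front (y t)).
  move=> ti im; have [->|ti'] := eqVneq i t.+1.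
    by rewrite (side_on_arc sg (walk_hit ystep t)).
  apply: (IH t.+1); [lia|lia|lia|exact: walk_hit|apply: Ft; lia].
have ht1 : 0 <= side sg (y t.+1) p.
  case/(on_arc_ends _ (y t).2): hr => a [b [a0 b0 ->]].
  rewrite side_linear (side_on_arc sg (walk_hit ystep t)) mulr0 addr0 mulr_ge0 ?(ltW a0) //.
  by rewrite ystep; apply/ltW/side_step_back.
have [->//|ts'] := eqVneq s t.+1.
rewrite leNgt; apply/negP => hs.
have [i it||h /andP[h0 h1] [hv [j jt hj]]] :=
  @first_exit R (m - t.+1) (fun i => side sg (y (t.+2 + i)%N) (front (y t)))
     (fun i => side sg (y (t.+2 + i)%N) p).
- by apply: Et; lia.
- exists (s - t.+2)%N; first lia.
  by rewrite subnKC; [apply: ltW|lia].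
pose q := lin (1 - h) (front (y t)) h p.
have hq i : side sg (y i) q = (1 - h) * side sg (y i) (front (y t)) + h * side sg (y i) p.
  by rewrite /q side_linear.
have Fq : trap q.
  by apply: trap_lin; rewrite ?subr_ge0 // ?subrK //; apply: Ft; lia.
have ge i : (t < i)%N -> (i <= m)%N -> 0 <= side sg (y i) q.
  move=> ti im; have [->|ti'] := eqVneq i t.+1.
    by rewrite hq (side_on_arc sg (walk_hit ystep t)) mulr0 add0r mulr_ge0.
  have := hv (i - t.+2)%N; rewrite subnKC; last lia.
  by rewrite -hq; apply; lia.
rewrite -hq in hj.
have jm : (t.+2 + j <= m)%N by lia.
have [i hi|hi|k0 [hk0 k0m rk]] := chain_barrier jm Fq hj.
- by apply: ge; lia.
- by apply: ge; lia.
(* If the crossing occurs at once, [q] is a multiple of [front (y t)], which is on the next arc and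
   not on the arc of [y t] itself. *)
have [h00|h0'] := eqVneq h 0.
  have rq : on_arc (y t.+1).1 q.
    apply: on_arc_scale => //; first exact: walk_hit.
    by rewrite h00 subr0.
  by have := inj _ k0m (disjP rq rk); lia.
have rq : on_arc (y t).1 q.
  rewrite /q linC; apply: on_arc_near_end => //; last by rewrite subr_ge0.
  by rewrite lt_neqAle eq_sym h0' h0.
by have := inj _ k0m (disjP rq rk); lia.
Qed.

Definition chain_interior p := trap p /\ forall s, (s <= m)%N -> 0 < side sg (y s) p.

(** Inside the trap the boundary of the region consists of points of chain arcs, so an arc that
    meets the interior cannot leave it without leaving the trap. *)
Lemma chain_interior_arc w p q : on_arc w p -> chain_interior p ->
  on_arc w q -> trap q -> chain_interior q.
Proof.
move=> wp [Fp ip] wq Fq; split=> // s sm; rewrite ltNge; apply/negP => hs.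
have [i it||h /andP[h0 h1] [hv [j jt hj]]] :=
  @first_exit R m.+1 (fun i => side sg (y i) p) (fun i => side sg (y i) q).
- by apply/ltW/ip.
- by exists s.
pose r := lin (1 - h) p h q.
have hr i : side sg (y i) r = (1 - h) * side sg (y i) p + h * side sg (y i) q.
  by rewrite /r side_linear.
have Fr : trap r by apply: trap_lin; rewrite ?subr_ge0 // ?subrK.
have wr : on_arc w r by apply: on_arc_conv; rewrite ?subr_ge0 // ?subrK.
rewrite -hr in hj.
have [i hi|hi|k0 [hk0 k0m rk]] := @chain_barrier j r jt Fr hj.
- by rewrite hr; apply: hv; lia.
- by rewrite hr; apply: hv; lia.
have := ip k0 k0m; rewrite -(disjP rk wr) in wp.
by rewrite (side_on_arc sg wp) ltxx.
Qed.

Lemma chain_interior_near p q : chain_interior p ->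
  exists2 N, 0 < N & chain_interior (lin N p 1 q).
Proof.
case=> Fp ip.
have [N1 N10 h1] := trap_near q Fp.
have [N2 N20 h2] := @large_multiple R 'I_m.+1 predT (fun i => side sg (y i) p)
  (fun i => side sg (y i) q) (fun i _ => ip i (ltn_ord i)).
exists (N1 + N2); first by rewrite addr_gt0.
split; first by apply: h1; rewrite lerDl ltW.
move=> s sm; have := h2 (N1 + N2) _ (Ordinal (sm : (s < m.+1)%N)) isT.
by rewrite side_linear mul1r; apply; rewrite lerDr ltW.
Qed.

Lemma chain_interior_lin p q s t : chain_interior p -> chain_interior q ->
  0 <= s -> 0 <= t -> 0 < s + t -> chain_interior (lin s p t q).
Proof.
move=> [Fp ip] [Fq iq] s0 t0 st; split; first exact: trap_lin.
by move=> i im; rewrite side_linear; apply: wmean_gt0 => //; [apply: ip|apply: iq].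
Qed.

Lemma chain_arc_interior t p : (t <= m)%N -> on_arc (y t).1 p -> ~ chain_interior p.
Proof. by move=> tm hr [_ /(_ t tm)]; rewrite (side_on_arc sg hr) ltxx. Qed.

Lemma chain_inside_lt s t : (s < t)%N -> (t < m)%N -> 0 < side sg (y s) (front (y t)).
Proof.
move=> st tm; rewrite lt_neqAle chain_inside ?(ltnW st) // andbT.
apply/eqP => /esym h0.
have sm : (s <= m)%N by lia.
have [s' hs|hs|k [hk km rk]] := chain_barrier sm (Ft tm) h0.
- by apply: chain_inside; lia.
- by apply: chain_inside; lia.
have rt : on_arc (y t.+1).1 (front (y t)) by apply: walk_hit.
have := inj km _ (disjP rk rt); lia.
Qed.

End ExitChain.

(** The measure of progress: nested regions alone would give no bound, but this is a subset of the
    finite set [I]. *)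
Definition chain_arcs sg x m : {set I} :=
  [set w | `[< exists2 p, on_arc w p & chain_interior sg x m p >]].

(* The walk leaves the trap along an arc that enters it in the other
   direction. The walk of opposite orientation starting from this arc encloses
   the first walk, since it cannot cross it. *)
Lemma exit_chain_restart sg x m : exit_chain sg x m ->
  entering (reverse (walk sg x m)) /\
  forall m', exit_chain (~~ sg) (reverse (walk sg x m)) m' ->
    chain_arcs sg x m \proper chain_arcs (~~ sg) (reverse (walk sg x m)) m'.
Proof.
case: m => [|m] ch; first by have := exit_chain_gt0 ch.
set y := walk sg x; set x' := reverse _.
have ystep : forall t, y t.+1 = step sg (y t) := walkS sg x.
have [hx inj Ft nF] := ch.
pose r := front (y m).
have Fr : trap r by apply: Ft.
have rr : on_arc (y m.+1).1 r by apply: walk_hit.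
have ent : entering x'.
  rewrite /entering /x' /reverse /back /front /= negbK; split=> //.
  have [b hb] := trapP rr Fr.
  have [bb|bb] := eqVneq b (y m.+1).2; first by case: nF; rewrite -/y /front -bb.
  by have -> : ~~ (y m.+1).2 = b by case: b (y m.+1).2 bb {hb} => [] [].
split=> // m' ch'; pose z := walk (~~ sg) x'.
have zstep : forall t, z t.+1 = step (~~ sg) (z t) := walkS (~~ sg) x'.
have [_ inj' Ft' nF'] := ch'.
have z0 : (z 0%N).1 = (y m.+1).1 by [].
(* The second walk never meets the interior of the first: it starts on a boundary arc, and if the
   arc of [z j.+1] met the interior, so would the arc of [z j] near the point where it hits. *)
have noz j p : (j <= m')%N -> on_arc (z j).1 p -> ~ chain_interior sg x m.+1 p.
  elim: j p => [|j IH] p jm hr hi.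
    by apply: (chain_arc_interior (leqnn m.+1) _ hi).
  have hz : on_arc (z j.+1).1 (front (z j)) by apply: walk_hit.
  have := chain_interior_arc ch hr hi hz (Ft' j jm).
  case/(@chain_interior_near _ _ _ _ (back (z j))) => N N0.
  by apply: IH; [exact: ltnW|exact: (on_arc_near (b := (z j).2) N0 ltr01)].
have z0H p : side (~~ sg) (z 0%N) p = side sg (y m.+1) p by rewrite /z /= /x' side_reverseN.
have r_z j : (0 < j)%N -> (j <= m')%N -> 0 < side (~~ sg) (z j) r.
  move=> j0 jm; have r0 : on_arc (z 0%N).1 r by rewrite z0.
  rewrite lt_neqAle (@chain_outside _ _ _ ch' j 0%N) ?j0 // andbT.
  apply/eqP => /esym hj.
  have [j' hj'|hj'|k [hk km rk]] := chain_barrier ch' jm Fr hj.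
  - have [->|j'0] := posnP j'; first by rewrite (side_on_arc _ r0).
    by apply: (@chain_outside _ _ _ ch' j' 0%N); rewrite ?j'0 //; lia.
  - by apply: (@chain_outside _ _ _ ch' j.+1 0%N).
  by have := inj' _ _ (leq0n _) km (disjP r0 rk); lia.
(* [d] points from the corner [r] into the angle between the last two arcs of the first walk, so
   that [N r + d] lies in both interiors for large [N]. *)
pose d := lin 1 (back (y m)) 1 (front (y m.+1)).
have hm1 : side sg (y m) r = 0 by apply: side_front.
have hm2 : side sg (y m.+1) r = 0 by apply: side_on_arc.
have dm1 : 0 < side sg (y m) d.
  by rewrite side_linear side_back mulr0 add0r mul1r ystep side_step_front.
have dm2 : 0 < side sg (y m.+1) d.
  by rewrite side_linear side_front mulr0 addr0 mul1r ystep side_step_back.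
have [N1 N10 h1] := trap_near d Fr.
have [N2 N20 h2] := @large_multiple R 'I_m predT (fun i => side sg (y i) r)
  (fun i => side sg (y i) d) (fun i _ => chain_inside_lt ch (ltn_ord i) (ltnSn m)).
have [N3 N30 h3] := @large_multiple R 'I_m' predT (fun i => side (~~ sg) (z i.+1) r)
  (fun i => side (~~ sg) (z i.+1) d) (fun i _ => r_z i.+1 isT (ltn_ord i)).
pose N := N1 + N2 + N3.
have N1N : N1 <= N by rewrite /N; lra.
have N2N : N2 <= N by rewrite /N; lra.
have N3N : N3 <= N by rewrite /N; lra.
pose p0 := lin N r 1 d.
have in0 : chain_interior sg x m.+1 p0.
  split; first exact: h1.
  move=> s; rewrite side_linear mul1r leq_eqVlt => /predU1P[->|].
    by rewrite -/(y m.+1) hm2 mulr0 add0r.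
  rewrite ltnS leq_eqVlt => /predU1P[->|sm]; first by rewrite -/(y m) hm1 mulr0 add0r.
  exact: (h2 N N2N (Ordinal sm) isT).
have in0' : chain_interior (~~ sg) x' m' p0.
  split; first exact: h1.
  move=> [|s] sm; rewrite side_linear mul1r.
    by rewrite -/(z 0%N) !z0H hm2 mulr0 add0r.
  exact: (h3 N N3N (Ordinal sm) isT).
(* The segment from [p0] to [p] stays in the convex first interior; to leave the second one it would
   have to meet an arc of the second walk there, against [noz]. *)
have sub p : chain_interior sg x m.+1 p -> chain_interior (~~ sg) x' m' p.
  move=> ip; split; first by case: ip.
  move=> s sm; rewrite ltNge; apply/negP => hs.
  have [i it||h /andP[g0 g1] [hv [j jt hj]]] :=
    @first_exit R m'.+1 (fun i => side (~~ sg) (z i) p0) (fun i => side (~~ sg) (z i) p).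
  - by case: in0' => _ h; apply/ltW/h.
  - by exists s.
  pose q := lin (1 - h) p0 h p.
  have hq i : side (~~ sg) (z i) q = (1 - h) * side (~~ sg) (z i) p0 + h * side (~~ sg) (z i) p.
    by rewrite /q side_linear.
  have iq : chain_interior sg x m.+1 q.
    by apply: chain_interior_lin; rewrite ?subr_ge0 // ?subrK.
  have Fq : trap q by case: iq.
  have ge i : (i < m'.+1)%N -> 0 <= side (~~ sg) (z i) q by move/hv; rewrite hq.
  rewrite -hq in hj.
  have [i hi|hi|k [hk km rk]] := chain_barrier ch' jt Fq hj.
  - by apply: (ge i); rewrite ltnW // -hi.
  - exact: (ge j.+1).
  exact: noz km rk iq.
apply/properP; split.
  apply/subsetP => w; rewrite !inE => /asboolP[p wp ip]; apply/asboolP.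
  by exists p => //; apply: sub.
(* The arc of [y m] bounds the first region but, followed backwards from [r], runs inside the
   second. *)
exists (y m).1; rewrite inE; last first.
  apply/asboolPn => -[p wp]; exact: (chain_arc_interior (leqnSn m) wp).
apply/asboolP.
have [N4 N40 h4] := trap_near (back (y m)) Fr.
have [N5 N50 h5] := @large_multiple R 'I_m' predT (fun i => side (~~ sg) (z i.+1) r)
  (fun i => side (~~ sg) (z i.+1) (back (y m))) (fun i _ => r_z i.+1 isT (ltn_ord i)).
have N45 : 0 < N4 + N5 by rewrite addr_gt0.
exists (lin (N4 + N5) r 1 (back (y m))).
  exact: (on_arc_near (b := (y m).2) N45 ltr01).
split; first by apply: h4; lra.
move=> [|s] sm; rewrite side_linear mul1r.
  by rewrite -/(z 0%N) !z0H hm2 mulr0 add0r ystep side_step_back.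
by apply: (h5 _ _ (Ordinal sm) isT); lra.
Qed.

Lemma trapped_swirl_exists x0 : entering x0 ->
  exists sg x n, trapped_swirl sg x n.
Proof.
move=> h0; case: (swirl_or_exit false h0) => [[x [n h]]|[m ch]].
  by exists false, x, n.
have [k hk] := ubnP (#|I| - #|chain_arcs false x0 m|).
elim: k false x0 m hk ch {h0} => // k IH sg x m hk ch.
have [ent hp] := exit_chain_restart ch.
case: (swirl_or_exit (~~ sg) ent) => [[x' [n h]]|[m' ch']].
  by exists (~~ sg), x', n.
apply: (IH (~~ sg) _ m' _ ch').
have := proper_card (hp m' ch').
have := subset_leq_card (subsetT (chain_arcs (~~ sg) (reverse (walk sg x m)) m')).
rewrite cardsT.
by move: hk; lia.
Qed.

End Trap.

End Diagram.

(** * Faces of the cube of poles *)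

Section FaceCombinatorics.
Local Open Scope nat_scope.

(* The six two-element subsets of [0..3], standing for the six faces of the
   cube whose vertices are the poles and their antipodes. *)
Definition top (f k : nat) : bool :=
  k \in nth [::] [:: [:: 0; 1]; [:: 0; 2]; [:: 0; 3]; [:: 1; 2]; [:: 1; 3]; [:: 2; 3]] f.

(* Relations [x_k > x_l] valid at the ends lying in the face [f], whose missing
   type is [m]. *)
Definition face_gt f m k l : bool :=
  [|| top f k && ~~ top f l, [&& l == m, k != m & top f k]
    | [&& k == m, l != m & ~~ top f l]].

(** Necessary conditions for an arc of type [i] with its end towards the pole in [f] and its other
    end in [f']: relations between coordinates other than [i] agree at both ends. *)
Definition face_link f m f' m' i : bool :=
  [&& top f i, ~~ top f' i, i != m, i != m' &
    all (fun k => all (fun l => [|| k == i, l == i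
       | ~~ (face_gt f m k l && face_gt f' m' l k)]) (iota 0 4)) (iota 0 4)].

(** [ms] lists the missing types of the faces and [ok] restricts the pairs of faces that an arc may
    join. Each of the three types present at a face needs a partner face for the other end of its
    arc. *)
Definition linked (ms : seq nat) (ok : nat -> nat -> bool) : bool :=
  all (fun f => all (fun i => (i == nth 0 ms f) ||
    has (fun f' => ok f f' &&
      (if top f i then face_link f (nth 0 ms f) f' (nth 0 ms f') i
       else face_link f' (nth 0 ms f') f (nth 0 ms f) i)) (iota 0 6))
    (iota 0 4)) (iota 0 6).

Fixpoint words (T : Type) (vs : seq T) n : seq (seq T) :=
  if n is n'.+1 then [seq x :: w | x <- vs, w <- words vs n'] else [:: [::]].

Lemma mem_words (T : eqType) (vs : seq T) (g : nat -> T) n m :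
  (forall i, g i \in vs) -> [seq g i | i <- iota m n] \in words vs n.
Proof.
move=> hg; elim: n m => //= n IH m.
by apply/allpairsP; exists (g m, [seq g i | i <- iota m.+1 n]); rewrite /= hg IH.
Qed.

(** A search over 4^6 choices of missing types and 2^6 colourings; the uncoloured test comes first,
    so that colourings are tried only for the choices that pass it. *)
Lemma no_bicolouring_seq :
  all (fun ms => ~~ linked ms (fun _ _ => true) ||
    all (fun cs => ~~ linked ms (fun f f' => nth true cs f != nth true cs f'))
      (words [:: true; false] 6)) (words (iota 0 4) 6).
Proof. lazy; reflexivity. Qed.

Lemma no_bicolouring (m : nat -> nat) (c : nat -> bool) :
  (forall f, m f < 4) ->
  (forall f i, f < 6 -> i < 4 -> i != m f -> exists f', [/\ f' < 6, c f != c f' &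
     if top f i then face_link f (m f) f' (m f') i
     else face_link f' (m f') f (m f) i]) -> False.
Proof.
move=> m4 h; pose ms := [seq m i | i <- iota 0 6]; pose cs := [seq c i | i <- iota 0 6].
have hm f : f < 6 -> nth 0 ms f = m f.
  by move=> f6; rewrite (nth_map 0) ?size_iota // nth_iota.
have hc f : f < 6 -> nth true cs f = c f.
  by move=> f6; rewrite (nth_map 0) ?size_iota // nth_iota.
have lk (ok : nat -> nat -> bool) : (forall f f', f < 6 -> f' < 6 -> c f != c f' -> ok f f') -> linked ms ok.
  move=> hok; apply/allP => f; rewrite mem_iota => /andP[_ f6].
  apply/allP => i; rewrite mem_iota => /andP[_ i4]; rewrite hm //.
  have [//|im] := eqVneq i (m f); apply/hasP.
  have [f' [f'6 cf hl]] := h f i f6 i4 im.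
  by exists f'; rewrite ?mem_iota // hm // hok.
have msw : ms \in words (iota 0 4) 6 by apply: mem_words => i; rewrite mem_iota m4.
have csw : cs \in words [:: true; false] 6 by apply: mem_words => i; case: (c i).
have /allP /(_ ms msw) := no_bicolouring_seq.
rewrite lk // orFb => /allP /(_ cs csw) /negP; apply.
by apply: lk => f f' f6 f'6; rewrite !hc.
Qed.

Definition top_separated : bool :=
  all (fun f => all (fun f' => (f == f') ||
    has (fun k => has (fun l => [&& top f k, ~~ top f' k, top f' l & ~~ top f l])
      (iota 0 4)) (iota 0 4)) (iota 0 6)) (iota 0 6).

Lemma top_sep f f' : f < 6 -> f' < 6 -> f != f' -> exists k l,
  [/\ k < 4, l < 4, top f k && ~~ top f' k & top f' l && ~~ top f l].
Proof.
have /allP H : top_separated by vm_compute.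
move=> f6 f'6 ff; have := H f; rewrite mem_iota f6 => /(_ isT) /allP /(_ f').
rewrite mem_iota f'6 (negbTE ff) => /(_ isT) /hasP [k]; rewrite mem_iota => /andP[_ k4].
move=> /hasP [l]; rewrite mem_iota => /andP[_ l4] /and4P[h1 h2 h3 h4].
by exists k, l; split=> //; apply/andP.
Qed.

End FaceCombinatorics.

(** * Families of arcs closed under blocking do not fit in a half-space *)

Section Hull.
Variables (R : realType) (I : finType).
Variables (ep : I -> bool -> vec R) (nxt : I -> bool -> I).
Hypothesis gramP : forall a, 0 < gram (ep a false) (ep a true).
Hypothesis hitP : forall a b, on_arc ep (nxt a b) (ep a b).

Section Refine.
Variables (P : pred I) (l g : vec R -> R).
Hypotheses (l_linear : linear_form l) (g_linear : linear_form g).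
Hypothesis P0 : exists a, P a.
Hypothesis Pnxt : forall a b, P a -> P (nxt a b).
Hypothesis Pl : forall a b, P a -> 0 < l (ep a b).

(** Take the largest ratio [g / l] over all ends. The arc that blocks an end attaining it contains
    that end in its interior, so both its ends attain the maximum too; the arcs with both ends
    extremal form [P']. *)
Lemma hull_refine : exists M (P' : pred I), [/\ exists a, P' a,
  forall a b, P' a -> P' (nxt a b), forall a, P' a -> P a
  & forall a b, P' a -> g (ep a b) = M * l (ep a b)].
Proof.
have [a0 Pa0] := P0.
pose f (x : I * bool) := g (ep x.1 x.2) / l (ep x.1 x.2).
have : P (a0, true).1 by [].
case/(@arg_maxP _ _ _ (a0, true) (fun x => P x.1) f) => -[a1 b1] /= Pa1 fmax.
pose M := f (a1, b1).
have le a b : P a -> g (ep a b) <= M * l (ep a b).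
  by move=> Pa; rewrite -ler_pdivrMr ?Pl //; apply: (fmax (a, b)).
have sat a b : P a -> g (ep a b) = M * l (ep a b) ->
    forall c, g (ep (nxt a b) c) = M * l (ep (nxt a b) c).
  move=> Pa he c; have /(on_arc_ends _ _ c)[s [t [s0 t0 hs]]] := hitP a b.
  move: he; rewrite hs g_linear l_linear => he.
  have h1 := le (nxt a b) c (Pnxt b Pa); have h2 := le (nxt a b) (~~ c) (Pnxt b Pa).
  apply/eqP; rewrite eq_le h1 /= -(ler_pM2l t0); nra.
exists M, (fun a => [&& P a, g (ep a true) == M * l (ep a true)
                     & g (ep a false) == M * l (ep a false)]); split.
- exists (nxt a1 b1); rewrite Pnxt //=.
  have hM : g (ep a1 b1) = M * l (ep a1 b1).
    by rewrite /M /f /= divfK // lt0r_neq0 // Pl.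
  by rewrite !(sat _ _ Pa1 hM) !eqxx.
- move=> a b /and3P[Pa /eqP ht /eqP hf]; rewrite Pnxt //=.
  by rewrite !(sat a b) ?eqxx //; case: b.
- by move=> a /and3P[].
- by move=> a [] /and3P[_ /eqP ht /eqP hf].
Qed.
End Refine.

(** Three refinements, one per coordinate, leave an arc whose two ends are multiples of one
    vector. *)
Lemma hull (P : pred I) (l : vec R -> R) : linear_form l -> (exists a, P a) ->
  (forall a b, P a -> P (nxt a b)) -> (forall a b, P a -> 0 < l (ep a b)) -> False.
Proof.
move=> hl P0 Pn Pl.
have [M1 [P1 [P10 P1n P1P h1]]] := hull_refine hl (@vx_linear R) P0 Pn Pl.
have P1l a b : P1 a -> 0 < l (ep a b) by move/P1P; apply: Pl.
have [M2 [P2 [P20 P2n P2P h2]]] := hull_refine hl (@vy_linear R) P10 P1n P1l.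
have P2l a b : P2 a -> 0 < l (ep a b) by move/P2P; apply: P1l.
have [M3 [P3 [[a P3a] P3n P3P h3]]] := hull_refine hl (@vz_linear R) P20 P2n P2l.
have P2a := P3P a P3a; have P1a := P2P a P2a.
have E b : ep a b = lin (l (ep a b)) (M1, M2, M3) 0 (M1, M2, M3).
  by apply: vec_eqP; rewrite ?(h1 a b P1a) ?(h2 a b P2a) ?(h3 a b P3a)
    /lin /vx /vy /vz /= mul0r addr0 mulrC.
by have := gramP a; rewrite (E true) (E false) gram_lin mulr0 mul0r subrr expr0n mul0r ltxx.
Qed.

End Hull.

(** * Periodic orbits of moves and swirls in a face *)

Section Faces.
Variables (R : realType) (I : finType).
Variables (ep : I -> bool -> vec R) (nxt : I -> bool -> I).
Hypothesis gramP : forall a, 0 < gram (ep a false) (ep a true).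
Hypothesis hitP : forall a b, on_arc ep (nxt a b) (ep a b).
Hypothesis disjP : forall a a' p, on_arc ep a p -> on_arc ep a' p -> a = a'.

(* [x k] is the [k]-th barycentric coordinate with respect to four rescaled
   poles of sum zero; only the differences [cdiff k l] are well defined, and
   moving towards the pole [tau a] increases the coordinate [tau a] alone. *)
Variables (tau : I -> 'I_4) (x : 'I_4 -> vec R -> R).
Hypothesis x_linear : forall k, linear_form (x k).
Definition cdiff k l p := x k p - x l p.
Hypothesis moveP : forall a, exists s t, [/\ 0 < s, 0 < t & forall k l,
  s * cdiff k l (ep a true) = t * cdiff k l (ep a false) + ((tau a == k)%:R - (tau a == l)%:R)].
Hypothesis planeP : forall k l, k != l -> forall p q r,
  cdiff k l p = 0 -> cdiff k l q = 0 -> cdiff k l r = 0 -> det3 p q r = 0.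

Hypothesis I0 : exists a : I, true.

Lemma cdiff_linear k l : linear_form (cdiff k l).
Proof. exact: linear_formB. Qed.

Lemma cdiffN k l p : cdiff l k p = - cdiff k l p.
Proof. by rewrite /cdiff opprB. Qed.

Definition psg (b : bool) : R := if b then 1 else -1.

Lemma travel a p b : on_arc ep a p -> exists c e, [/\ 0 < c, 0 < e & forall k l,
  c * cdiff k l (ep a b) = cdiff k l p + e * psg b * ((tau a == k)%:R - (tau a == l)%:R)].
Proof.
case=> s [t [s0 t0 ->]]; have [u [v [u0 v0 h]]] := moveP a.
case: b; rewrite /psg.
  exists (s * u / v + t), (s / v); split; first by rewrite addr_gt0 // divr_gt0 ?mulr_gt0.
    by rewrite divr_gt0.
  move=> k l; rewrite cdiff_linear -[in RHS](mulfK (lt0r_neq0 v0) (cdiff k l (ep a false))).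
  rewrite [_ * v]mulrC; have /eqP := h k l; rewrite -subr_eq => /eqP <-.
  by field; rewrite lt0r_neq0.
exists (s + t * v / u), (t / u); split; first by rewrite addr_gt0 // divr_gt0 ?mulr_gt0.
  by rewrite divr_gt0.
move=> k l; rewrite cdiff_linear -[in RHS](mulfK (lt0r_neq0 u0) (cdiff k l (ep a true))).
rewrite [_ * u]mulrC h; by field; rewrite lt0r_neq0.
Qed.

Lemma exists_cdiff_ge0 k l : k != l -> exists a b, 0 <= cdiff k l (ep a b).
Proof.
move=> kl; apply: contrapT => hn.
apply: (@hull _ _ _ _ gramP hitP predT (fun p => - cdiff k l p)) => //.
  exact/linear_formN/cdiff_linear.
move=> a b _; rewrite oppr_gt0 ltNge; apply/negP => h.
by apply: hn; exists a, b.
Qed.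

Section Face.
Variable T : {set 'I_4}.

Definition face : vec R -> Prop :=
  trap (fun kl : 'I_4 * 'I_4 => (kl.1 \in T) && (kl.2 \notin T))
       (fun kl => cdiff kl.1 kl.2).

Lemma faceP p : face p <-> (forall k l, k \in T -> l \notin T -> 0 < cdiff k l p).
Proof.
split=> [h k l kT lT|h [k l] /andP[kT lT]]; last exact: h.
by apply: (h (k, l)); rewrite /= kT lT.
Qed.

Definition toward a : bool := tau a \in T.
Definition toward_end a := ep a (toward a).
Definition adv a := nxt a (toward a).

Lemma travel_face a p : on_arc ep a p -> exists2 c, 0 < c &
  forall k l, k \in T -> l \notin T -> cdiff k l p <= c * cdiff k l (toward_end a).
Proof.
move=> hr; have [c [e [c0 e0 h]]] := travel (toward a) hr; exists c => // k l kT lT.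
rewrite h lerDl -mulrA mulr_ge0 ?(ltW e0) // /toward /psg.
case: ifP => ta.
  have -> : (tau a == l) = false by apply/eqP => E; rewrite -E ta in lT.
  by rewrite subr0 mul1r.
have -> : (tau a == k) = false by apply/eqP => E; rewrite E kT in ta.
by rewrite sub0r mulrNN mul1r.
Qed.

Lemma face_toward a p : on_arc ep a p -> face p -> face (toward_end a).
Proof.
move=> /travel_face [c c0 h] /faceP Fp; apply/faceP => k l kT lT.
by rewrite -(pmulr_rgt0 _ c0); apply: lt_le_trans (h k l kT lT); apply: Fp.
Qed.

Definition tsg k : R := psg (k \in T).

(** [A k] adds up, with the accumulated scalings, how far the arcs of type [k] move the point. The
    arcs counted run from the first to the [n]-th iterate; the starting arc is left out. *)
Lemma iter_travel a n : exists C (A : 'I_4 -> R), [/\ 0 < C, forall k, 0 <= A k,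
  forall k, (0 < A k) <-> (exists2 i, (i < n)%N & tau (iter i.+1 adv a) = k)
  & forall k l, C * cdiff k l (toward_end (iter n adv a))
      = cdiff k l (toward_end a) + (tsg k * A k - tsg l * A l)].
Proof.
elim: n => [|n [C [A [C0 A0 AP h]]]].
  exists 1, (fun _ => 0); split=> // [k|k l]; last by rewrite mul1r !mulr0 subrr addr0.
  by rewrite ltxx; split=> // -[].
pose z := iter n adv a; have hz : on_arc ep (iter n.+1 adv a) (toward_end z) by apply: hitP.
have [c [e [c0 e0 hc]]] := travel (toward (iter n.+1 adv a)) hz.
set t := iter n.+1 adv a in hc hz *.
exists (C * c), (fun k => A k + C * e * (tau t == k)%:R).
have Ce : 0 < C * e by apply: mulr_gt0.
split; first exact: mulr_gt0.
- by move=> k; rewrite addr_ge0 // mulr_ge0 ?ler0n // ltW.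
- move=> k; split.
    have [tk _|tk] := eqVneq (tau t) k; first by exists n.
    rewrite mulr0 addr0 => /AP [i hi hk]; exists i => //; exact: ltnW.
  move=> [i]; rewrite ltnS leq_eqVlt => /predU1P[->|hi] hk.
    by rewrite -/t in hk; rewrite hk eqxx mulr1; apply: ltr_wpDl.
  by apply: ltr_wpDr; [rewrite mulr_ge0 ?ler0n // ltW|apply/AP; exists i].
move=> k l; rewrite -mulrA /toward_end hc mulrDr h.
have E j : tsg j * (C * e * (tau t == j)%:R) = C * (e * psg (toward t) * (tau t == j)%:R).
  by rewrite /tsg /toward; case: eqVneq => [->|_] /=; ring.
by rewrite !mulrDr mulrN !E; ring.
Qed.

Hypothesis T0 : exists k, k \in T.
Hypothesis T1 : exists l, l \notin T.

Lemma adv_hit a : on_arc ep (adv a) (toward_end a).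
Proof. exact: hitP. Qed.

(** At most one type is absent from a periodic orbit. Were [k] and [l] both absent, then either
    [C = 1] and all [A] vanish by comparison with [k], although the first arc has some type; or
    [cdiff k l] vanishes on two successive arcs, which would be coplanar, against [transversal]. *)
Lemma orbit_plane y (C : R) (A : 'I_4 -> R) n : (0 < n)%N -> iter n adv y = y ->
  0 < C -> (forall k, 0 <= A k) ->
  (forall k, (0 < A k) <-> (exists2 i, (i < n)%N & tau (iter i.+1 adv y) = k)) ->
  (forall k l, C * cdiff k l (toward_end y) = cdiff k l (toward_end y) + (tsg k * A k - tsg l * A l)) ->
  forall k l, k != l -> 0 < A k + A l.
Proof.
move=> n0 hn C0 A0 AP hC k l kl; rewrite lt_neqAle addr_ge0 // andbT eq_sym.
rewrite paddr_eq0 //; apply/negP => /andP[/eqP Ak /eqP Al].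
have type i m : A m = 0 -> (i < n)%N -> tau (iter i.+1 adv y) != m.
  move=> Am hi; apply/eqP => hm.
  by have : 0 < A m; [apply/AP; exists i|rewrite Am ltxx].
have [C1|C1] := eqVneq C 1.
  have z m : A m = 0.
    have := hC m k; rewrite C1 mul1r Ak mulr0 subr0 -{1}[cdiff m k _]addr0 => /addrI/esym/eqP.
    rewrite mulf_eq0 /tsg /psg; case: ifP => _; first by rewrite oner_eq0 => /eqP.
    by rewrite oppr_eq0 oner_eq0 => /eqP.
  by have := type 0%N _ (z (tau (adv y))) n0; rewrite eqxx.
have dy : cdiff k l (toward_end y) = 0.
  have := hC k l; rewrite Ak Al !mulr0 subrr addr0 => /eqP.
  rewrite -subr_eq0 -{2}[cdiff k l _]mul1r -mulrBl mulf_eq0 subr_eq0 (negbTE C1) /=.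
  by move/eqP.
(* By periodicity the starting arc is also the last one counted, hence the index [n.-1]. *)
have ty m : A m = 0 -> tau y != m.
  by move=> Am; have := type n.-1 m Am; rewrite prednK // hn; apply.
have both a b : (forall m, A m = 0 -> tau a != m) -> cdiff k l (ep a b) = 0 ->
    forall b', cdiff k l (ep a b') = 0.
  move=> ta hb b'; have [u [v [u0 v0 /(_ k l)]]] := moveP a.
  rewrite (negbTE (ta k Ak)) (negbTE (ta l Al)) subrr addr0.
  case: b b' hb => [] [] // -> h; apply/eqP.
    by move: h; rewrite mulr0 => /esym/eqP; rewrite mulf_eq0 (gt_eqF v0).
  by move: h; rewrite mulr0 => /eqP; rewrite mulf_eq0 (gt_eqF u0).
have dn b : cdiff k l (ep (adv y) b) = 0.
  have [c [e [c0 e0 /(_ k l)]]] := travel b (adv_hit y).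
  rewrite dy (negbTE (type 0%N k Ak n0)) (negbTE (type 0%N l Al n0)) subrr mulr0 addr0.
  by move/eqP; rewrite mulf_eq0 (gt_eqF c0) => /eqP.
have := transversal gramP hitP disjP y (toward y) true.
by rewrite (planeP kl (dn _) (dn _) (both _ _ ty dy _)) eqxx.
Qed.

Lemma face_iter a : face (toward_end a) -> forall n, face (toward_end (iter n adv a)).
Proof. by move=> Fa; elim=> //= n IH; apply: (face_toward (adv_hit _) IH). Qed.

(** By [hull] some end has [cdiff k l] nonnegative, for one [k] in [T] and one [l] outside, and
    moves preserve this. The orbit relation [(C - 1) * cdiff k l = A k + A l] then forces [C > 1]
    and, read for all such pairs, puts the point in the face. *)
Lemma face_cycle : exists y n (C : R) (A : 'I_4 -> R),
  [/\ (0 < n)%N, iter n adv y = y,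
      (forall i j, (i < n)%N -> (j < n)%N -> iter i adv y = iter j adv y -> i = j)
    & face (toward_end y)] /\
  [/\ 1 < C, forall k, 0 <= A k, forall k l, k != l -> 0 < A k + A l,
      forall k, (0 < A k) <-> (exists2 i, (i < n)%N & tau (iter i.+1 adv y) = k)
    & forall k l, (C - 1) * cdiff k l (toward_end y) = tsg k * A k - tsg l * A l].
Proof.
have [k kT] := T0; have [l lT] := T1.
have kl : k != l by apply: contraNneq lT => <-.
have [a [b hab]] := exists_cdiff_ge0 kl.
have ge n : 0 <= cdiff k l (toward_end (iter n adv (nxt a b))).
  elim: n => [|n IH].
    have [c c0 h] := travel_face (hitP a b).
    by rewrite -(pmulr_rge0 _ c0); apply: le_trans (h k l kT lT).
  have [c c0 h] := travel_face (adv_hit (iter n adv (nxt a b))).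
  by rewrite -(pmulr_rge0 _ c0); apply: le_trans (h k l kT lT).
pose z i := iter i adv (nxt a b).
have [s [t [st hst inj]]] := first_repeat z.
have z' i : iter i adv (z s) = z (i + s)%N by rewrite /z iterD.
have per : iter (t - s) adv (z s) = z s by rewrite z' subnK // ltnW.
have [C [A [C0 A0 AP hC]]] := iter_travel (z s) (t - s).
rewrite per in hC.
have n0 : (0 < t - s)%N by rewrite subn_gt0.
have Apos := orbit_plane n0 per C0 A0 AP hC.
have hC1 k' l' : (C - 1) * cdiff k' l' (toward_end (z s)) = tsg k' * A k' - tsg l' * A l'.
  by rewrite mulrBl hC mul1r addrAC subrr add0r.
have tk m : m \in T -> tsg m = 1 by rewrite /tsg /psg => ->.
have tl m : m \notin T -> tsg m = -1 by rewrite /tsg /psg => /negbTE ->.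
have C1 : 1 < C.
  rewrite ltNge; apply/negP => C1.
  have := hC1 k l; rewrite tk // tl // mul1r mulN1r opprK => h.
  by have := Apos k l kl; have := ge s; rewrite -/(z s); nra.
exists (z s), (t - s)%N, C, A; split; split=> //.
- move=> i j it jt; rewrite !z' => /inj h; have := h _ _; lia.
- apply/faceP => k' l' kT' lT'.
  have kl' : k' != l' by apply: contraNneq lT' => <-.
  have := hC1 k' l'; rewrite (tk k') // (tl l') // mul1r mulN1r opprK => h.
  have C10 : 0 < C - 1 by rewrite subr_gt0.
  by rewrite -(pmulr_rgt0 _ C10) h; apply: Apos.
Qed.

Definition face_ends : {set I * bool} :=
  [set s | (s.2 == toward s.1) && `[< face (ep s.1 s.2) >]].

Lemma face_endsP a : ((a, toward a) \in face_ends) <-> face (toward_end a).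
Proof. by rewrite inE eqxx; split=> [/asboolP|h]; last exact/asboolP. Qed.

Lemma face_ends_ge3 : (3 <= #|face_ends|)%N.
Proof.
have [y [n [C [A [[n0 hn inj Fy] [C1 A0 Apos AP hC]]]]]] := face_cycle.
have sub : [set k | 0 < A k] \subset [set tau s.1 | s in face_ends].
  apply/subsetP => k; rewrite inE => /AP [i hi hk]; apply/imsetP.
  exists (iter i.+1 adv y, toward (iter i.+1 adv y)); last by rewrite hk.
  by apply/face_endsP/face_iter.
apply: leq_trans (leq_imset_card (fun s => tau s.1) _).
apply: leq_trans (subset_leq_card sub).
have le1 : (#|[set k | ~~ (0 < A k)%R]| <= 1)%N.
  apply/card_le1_eqP => k l; rewrite !inE -!leNgt => hk hl.
  apply/eqP/negPn/negP => kl; have := Apos _ _ kl; lra.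
have := cardsC [set k | 0 < A k]; rewrite card_ord.
have -> : ~: [set k | 0 < A k] = [set k | ~~ (0 < A k)] by apply/setP => k; rewrite !inE.
by move: le1; lia.
Qed.

(** Otherwise the arcs with an end in the face would have both ends there and form a family closed
    under blocking inside a half-space, which [hull] excludes. *)
Lemma face_entering : exists s : I * bool, ~ face (back ep s) /\ face (front ep s).
Proof.
have [k kT] := T0; have [l lT] := T1.
apply: contrapT => hn.
have opp a b : face (ep a b) -> face (ep a (~~ b)).
  by move=> Fb; apply: contrapT => nF; apply: hn; exists (a, b).
have all2 a b c : face (ep a b) -> face (ep a c).
  by move=> h; case: b c h => [] [] //; [apply: (opp a true)|apply: (opp a false)].
have [y [_ [_ [_ [[_ _ _ Fy] _]]]]] := face_cycle.
apply: (@hull _ _ _ _ gramP hitP (fun a => `[< face (ep a true) >]) (cdiff k l)).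
- exact: cdiff_linear.
- by exists y; apply/asboolP; apply: all2 Fy.
- move=> a b /asboolP Fa; apply/asboolP.
  by apply: (all2 _ _ _ (face_toward (hitP a b) (all2 _ _ b Fa))).
- by move=> a b /asboolP/(all2 _ _ b)/faceP; apply.
Qed.

Lemma face_swirl : exists sg s n, trapped_swirl ep nxt
  (fun kl : 'I_4 * 'I_4 => (kl.1 \in T) && (kl.2 \notin T))
  (fun kl => cdiff kl.1 kl.2) sg s n.
Proof.
have [s hs] := face_entering.
apply: (trapped_swirl_exists gramP hitP disjP _ _ _ hs).
- by have [k kT] := T0; have [l lT] := T1; exists (k, l); rewrite /= kT lT.
- by move=> kl; apply: cdiff_linear.
- by move=> a p hr Fp; exists (toward a); apply: (face_toward hr Fp).
Qed.

(** For an absent type [A m = 0], so the orbit relation determines the sign of [x_k - x_m]. These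
    are the relations that [face_gt] adds to those defining the face. *)
Lemma orbit_sign a n m : (0 < n)%N -> iter n adv a = a -> face (toward_end a) ->
  (forall i, tau (iter i adv a) != m) ->
  forall i, 0 < tsg (tau (iter i.+1 adv a)) * cdiff (tau (iter i.+1 adv a)) m (toward_end a).
Proof.
move=> n0 hn Fa hm i.
have [C [A [C0 A0 AP hC]]] := iter_travel a n.
rewrite hn in hC.
have Apos := orbit_plane n0 hn C0 A0 AP hC.
have hC1 k' l' : (C - 1) * cdiff k' l' (toward_end a) = tsg k' * A k' - tsg l' * A l'.
  by rewrite mulrBl hC mul1r addrAC subrr add0r.
have C1 : 1 < C.
  have [k kT] := T0; have [l lT] := T1.
  have kl : k != l by apply: contraNneq lT => <-.
  have := hC1 k l; rewrite /tsg kT (negbTE lT) /psg mul1r mulN1r opprK => h.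
  have dk : 0 < cdiff k l (toward_end a) := proj1 (faceP _) Fa k l kT lT.
  by have := Apos k l kl; rewrite -h (pmulr_lgt0 _ dk) subr_gt0.
have Am : A m = 0.
  apply/eqP; rewrite eq_le A0 andbT leNgt; apply/negP => /AP [j _ hj].
  by have := hm j.+1; rewrite hj eqxx.
set k := tau _; have km : k != m by apply: hm.
have Ak : 0 < A k by have := Apos k m km; rewrite Am addr0.
have C10 : 0 < C - 1 by rewrite subr_gt0.
rewrite -(pmulr_rgt0 _ C10) mulrCA hC1 Am mulr0 subr0 mulrA.
suff -> : tsg k * tsg k = 1 by rewrite mul1r.
by rewrite /tsg /psg; case: ifP => _; rewrite ?mulrNN mulr1.
Qed.

(* The orbit is a triangle, so its three turns have the sign of a single
   determinant; [m] is the only type that does not occur. *)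
Lemma face_three : #|face_ends| = 3%N -> exists (m : 'I_4) (c : bool),
  [/\ forall s, s \in face_ends -> tau s.1 != m /\
        (forall k, k != m -> 0 < tsg k * cdiff k m (ep s.1 s.2)),
      forall k, k != m -> exists2 s, s \in face_ends & tau s.1 = k
    & forall s, s \in face_ends -> exists2 s', nxt s'.1 s'.2 = s.1
        & 0 < side ep c s' (front ep s)].
Proof.
move=> card3.
have [y [n [C [A [[n0 hn inj Fy] [C1 A0 Apos AP hC]]]]]] := face_cycle.
pose z i := iter i adv y; pose st a := (a, toward a).
have zin i : st (z i) \in face_ends by apply/face_endsP; apply: face_iter.
have stI : injective (fun i : 'I_n => st (z i)).
  by move=> i j [h _]; apply: val_inj; exact: inj (ltn_ord i) (ltn_ord j) h.
have n3 : (n <= 3)%N.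
  rewrite -card3 -[n]card_ord -(card_imset _ stI); apply: subset_leq_card.
  by apply/subsetP => s /imsetP[i _ ->].
have wrap i : (i < n)%N -> exists2 j, (j < n)%N & z i.+1 = z j.
  move=> hi; have [E|ne] := eqVneq i.+1 n; last by exists i.+1 => //; lia.
  by exists 0%N => //; rewrite E /z hn.
have sub : [set k | 0 < A k] \subset [set tau (z i) | i : 'I_n].
  apply/subsetP => k; rewrite inE => /AP [i hi <-]; apply/imsetP.
  by have [j hj E] := wrap i hi; exists (Ordinal hj) => //; rewrite -/(z _) E.
have cA : (#|[set k | (0 < A k)%R]| <= n)%N.
  rewrite -[X in (_ <= X)%N]card_ord; apply: leq_trans (leq_imset_card (fun i : 'I_n => tau (z i)) _).
  exact: subset_leq_card.
have [m Am] : exists m, A m = 0.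
  apply: contrapT => h; move: cA.
  have -> : [set k | (0 < A k)%R] = setT.
    apply/setP => k; rewrite !inE lt_neqAle A0 andbT eq_sym.
    by apply/eqP => E; apply: h; exists k.
  by rewrite cardsT card_ord; lia.
have Ak k : k != m -> 0 < A k by move=> km; have := Apos k m km; rewrite Am addr0.
have types k : k != m -> exists2 i, (i < n)%N & tau (z i.+1) = k by move/Ak/AP.
have nm i : (i < n)%N -> tau (z i.+1) != m.
  by move=> hi; apply/eqP => h; have : 0 < A m; [apply/AP; exists i|rewrite Am ltxx].
have n3' : n = 3%N.
  apply/eqP; rewrite eqn_leq n3 /=; apply: leq_trans cA.
  have -> : [set k | (0 < A k)%R] = ~: [set m].
    apply/setP => k; rewrite !inE; have [->|/Ak ->//] := eqVneq k m.
    by rewrite Am ltxx.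
  by have := cardsC [set m]; rewrite cards1 card_ord; lia.
have z3 i : z (i + 3)%N = z i by rewrite /z iterD -n3' hn.
have nm' i : tau (z i) != m.
  have [q [r [r3 ->]]] : exists q r, (r < 3)%N /\ i = (r + q * 3)%N.
    by exists (i %/ 3)%N, (i %% 3)%N; split; [rewrite ltn_mod|lia].
  elim: q => [|q IH]; last by rewrite (_ : (r + q.+1 * 3 = r + q * 3 + 3)%N) ?z3 //; lia.
  rewrite addn0 -z3 (_ : (r + 3 = (r + 2).+1)%N); last lia.
  case: r r3 => [|r] r3; first by apply: nm; rewrite n3'.
  have -> : ((r.+1 + 2).+1 = (r + 3).+1)%N by lia.
  have -> : z (r + 3).+1 = z r.+1 by rewrite -(z3 r.+1) addSn.
  by apply: nm; rewrite n3'; lia.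
have all_z s : s \in face_ends -> exists i, s = st (z i).
  have <- : [set st (z i) | i : 'I_n] = face_ends.
    apply/eqP; rewrite eqEcard card3 (card_imset _ stI) card_ord n3' leqnn andbT.
    by apply/subsetP => u /imsetP[i _ ->].
  by case/imsetP => i _ ->; exists i.
have per i : iter 3 adv (z i) = z i by rewrite -[RHS]z3 /z addnC iterD.
pose P i := toward_end (z i).
have P3 i : P (i + 3)%N = P i by rewrite /P z3.
(* Expressing the hit point by the ends of the hit arc identifies the turn made there, up to a
   positive factor, with the orientation of the triangle of hit points. *)
have edge i : exists2 c, 0 < c &
    det3 (P i) (P i.+1) (P i.+2) = c * det3 (back ep (st (z i.+1))) (P i.+1) (P i.+2).
  have /(on_arc_ends _ _ (toward (z i.+1))) [s [t [s0 t0 he]]] := adv_hit (z i).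
  exists s => //; rewrite {1}/P he -/(toward_end _) -/(P i.+1) /back /=.
  move: (P i.+1) (P i.+2) (ep _ _) => u v w.
  by rewrite /det3 /lin /vx /vy /vz /=; ring.
have turn i : det3 (P i.+1) (P i.+2) (P i.+3) = det3 (P i) (P i.+1) (P i.+2).
  have -> : P i.+3 = P i by rewrite -(P3 i) addn3.
  by rewrite -det3rot.
have turn0 i : det3 (P i) (P i.+1) (P i.+2) = det3 (P 0%N) (P 1%N) (P 2%N).
  by elim: i => // i IH; rewrite turn.
have hitz i : (st (z i.+1)).1 = nxt (st (z i)).1 (st (z i)).2 by [].
have tne : det3 (P 0%N) (P 1%N) (P 2%N) != 0.
  have [c c0 ->] := edge 0%N; apply: mulf_neq0; first exact: lt0r_neq0.
  have [e e0 he] := side_turn hitP false (hitz 1%N).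
  rewrite (_ : det3 _ _ _ = side ep false (st (z 1%N)) (front ep (st (z 2)))); last first.
    by rewrite /side expr0 mul1r.
  by rewrite he; apply: mulf_neq0; [exact: lt0r_neq0|exact: (side_hit gramP hitP disjP)].
(* The colour is the direction of the swirl: it is chosen so that [(-1) ^+ c] times the determinant
   is positive. *)
exists m, (det3 (P 0%N) (P 1%N) (P 2%N) < 0); split.
- move=> s /all_z [i ->] /=; split=> // k km.
  have [j hj <-] := types k km.
  have hz q : z (j.+1 + q * 3)%N = z j.+1.
    elim: q => [|q IH]; first by rewrite addn0.
    by rewrite (_ : (j.+1 + q.+1 * 3 = j.+1 + q * 3 + 3)%N) ?z3 //; lia.
  have hq : z j.+1 = iter (j + i * 2).+1 adv (z i).
    by rewrite -(hz i) /z -iterD; congr (iter _ adv y); lia.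
  have nmz q : tau (iter q adv (z i)) != m by rewrite /z -iterD; exact: (nm' (q + i)%N).
  rewrite hq; exact: (@orbit_sign (z i) 3 m isT (per i) (face_iter Fy i) nmz).
- by move=> k /types [i hi <-]; exists (st (z i.+1)).
- move=> s /all_z [i ->].
  have -> : z i = z (i + 2).+1 by rewrite -addnS z3.
  exists (st (z (i + 2)%N)) => //.
  have [c c0 hc] := edge (i + 1)%N; move: tne hc.
  rewrite turn0 -[in z _]addnS /side /front /= -/(P _) -/(P _) addn1 addn2 => tne hc.
  have -> : det3 (back ep (st (z i.+2))) (P i.+2) (P i.+3) = det3 (P 0%N) (P 1%N) (P 2%N) / c.
    by rewrite hc mulrC mulKf ?lt0r_neq0.
  rewrite mulrA pmulr_lgt0 ?invr_gt0 //.
  by rewrite -normrEsign ?num_real // normr_gt0.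
Qed.

End Face.

(** * Counting ends over the six faces *)

Definition face_set (f : nat) : {set 'I_4} := [set k : 'I_4 | top f k].

Lemma fT_sep f f' : (f < 6)%N -> (f' < 6)%N -> f != f' -> exists k l,
  [/\ k \in face_set f, k \notin face_set f', l \in face_set f' & l \notin face_set f].
Proof.
move=> f6 f'6 /(top_sep f6 f'6) [k [l [k4 l4 /andP[h1 h2] /andP[h3 h4]]]].
by exists (Ordinal k4), (Ordinal l4); rewrite !inE.
Qed.

Lemma fT_in f : (f < 6)%N -> exists k, k \in face_set f.
Proof.
move=> f6; case: (posnP f) => [->|f0].
  by exists (inord 0); rewrite inE inordK.
by rewrite lt0n in f0; have [k [_ [h _ _ _]]] := @fT_sep f 0 f6 isT f0; exists k.
Qed.

Lemma fT_notin f : (f < 6)%N -> exists k, k \notin face_set f.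
Proof.
move=> f6; case: (posnP f) => [->|f0].
  by exists (inord 3); rewrite inE inordK.
by rewrite lt0n in f0; have [_ [k [_ _ _ h]]] := @fT_sep f 0 f6 isT f0; exists k.
Qed.

Lemma face_disjoint f f' p : (f < 6)%N -> (f' < 6)%N ->
  face (face_set f) p -> face (face_set f') p -> f = f'.
Proof.
move=> f6 f'6 /faceP F1 /faceP F2; apply/eqP/negPn/negP => /(fT_sep f6 f'6).
case=> k [l [k1 k2 l1 l2]]; have := F1 k l k1 l2; have := F2 l k l1 k2.
by rewrite cdiffN; lra.
Qed.

Lemma face_ends_uniq (f f' : 'I_6) s :
  s \in face_ends (face_set f) -> s \in face_ends (face_set f') -> f = f'.
Proof.
rewrite !inE => /andP[_ /asboolP h] /andP[_ /asboolP h'].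
exact/val_inj/(face_disjoint (ltn_ord _) (ltn_ord _) h h').
Qed.

Lemma sum_face_ends : (\sum_(f < 6) #|face_ends (face_set f)| <= 2 * #|I|)%N.
Proof.
have -> : (2 * #|I| = \sum_(s : I * bool) 1)%N.
  by rewrite sum1_card card_prod card_bool mulnC.
under eq_bigr do rewrite -sum1_card big_mkcond /=.
rewrite exchange_big /=.
apply: leq_sum => s _; rewrite -big_mkcond /= sum1_card.
apply/card_le1_eqP => f f' h h'; exact: (face_ends_uniq h' h).
Qed.

Lemma face_set_ends_ge3 f : (f < 6)%N -> (3 <= #|face_ends (face_set f)|)%N.
Proof. by move=> f6; apply: face_ends_ge3; [apply: fT_in|apply: fT_notin]. Qed.

Lemma nine_arcs : (9 <= #|I|)%N.
Proof.
have : (\sum_(f < 6) 3 <= \sum_(f < 6) #|face_ends (face_set f)|)%N.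
  by apply: leq_sum => f _; apply: face_set_ends_ge3.
by rewrite sum_nat_const card_ord; have := sum_face_ends; lia.
Qed.

(** * Diagrams with exactly nine arcs *)

Section Nine.
Hypothesis I9 : #|I| = 9%N.

Lemma nine_sum : (\sum_(f < 6) #|face_ends (face_set f)| = 18)%N.
Proof.
have : (\sum_(f < 6) 3 <= \sum_(f < 6) #|face_ends (face_set f)|)%N.
  by apply: leq_sum => f _; apply: face_set_ends_ge3.
by rewrite sum_nat_const card_ord; have := sum_face_ends; rewrite I9; lia.
Qed.

Lemma nine_three f : (f < 6)%N -> #|face_ends (face_set f)| = 3%N.
Proof.
move=> f6; apply/eqP; rewrite eqn_leq face_set_ends_ge3 // andbT.
have := nine_sum; rewrite (bigD1 (Ordinal f6)) //=.
have : (\sum_(g < 6 | g != Ordinal f6) 3 <=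
        \sum_(g < 6 | g != Ordinal f6) #|face_ends (face_set g)|)%N.
  by apply: leq_sum => g _; apply: face_set_ends_ge3.
rewrite sum_nat_const.
have := cardC1 (Ordinal f6); rewrite card_ord /= => ->.
by move: (\sum_(g < 6 | _) _)%N => S; lia.
Qed.

Lemma nine_end s : exists2 f, (f < 6)%N & s \in face_ends (face_set f).
Proof.
apply: contrapT => hn.
have : (\sum_(f < 6) #|face_ends (face_set f)| <= \sum_(t : I * bool | t != s) 1)%N.
  under eq_bigr do rewrite -sum1_card big_mkcond /=.
  rewrite exchange_big /= (bigD1 s) //=.
  rewrite big1 ?add0n => [|f _]; last first.
    by case: ifP => // h; case: hn; exists f.
  apply: leq_sum => t _; rewrite -big_mkcond /= sum1_card.
  apply/card_le1_eqP => f f' h h'; exact: (face_ends_uniq h' h).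
rewrite nine_sum sum1_card cardC1 card_prod card_bool I9.
by [].
Qed.

Lemma cdiff_transfer a k l : k != tau a -> l != tau a ->
  (0 < cdiff k l (ep a true)) = (0 < cdiff k l (ep a false)).
Proof.
move=> ka la; have [u [v [u0 v0 /(_ k l)]]] := moveP a.
rewrite ![tau a == _]eq_sym (negbTE ka) (negbTE la) subrr addr0 => h.
by rewrite -(pmulr_rgt0 _ u0) h pmulr_rgt0.
Qed.

Hypothesis one_sided : forall a b a' b', nxt a b = nxt a' b' ->
  0 < det3 (ep (nxt a b) false) (ep (nxt a b) true) (ep a (~~ b)) *
      det3 (ep (nxt a b) false) (ep (nxt a b) true) (ep a' (~~ b')).

Lemma nine_not_one_sided : False.
Proof.
pose Pf (f : nat) (mc : 'I_4 * bool) :=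
  [/\ forall s, s \in face_ends (face_set f) -> tau s.1 != mc.1 /\
        (forall k, k != mc.1 -> 0 < tsg (face_set f) k * cdiff k mc.1 (ep s.1 s.2)),
      forall k, k != mc.1 -> exists2 s, s \in face_ends (face_set f) & tau s.1 = k
    & forall s, s \in face_ends (face_set f) -> exists2 s', nxt s'.1 s'.2 = s.1
        & 0 < side ep mc.2 s' (front ep s)].
have exPf (f : 'I_6) : exists mc, Pf f mc.
  have [m [c h]] := face_three (fT_in (ltn_ord f)) (fT_notin (ltn_ord f))
    (nine_three (ltn_ord f)).
  by exists (m, c).
have [g hg] := choice exPf.
pose m n := val (g (inord n)).1; pose c n := (g (inord n)).2.
have Pn n (n6 : (n < 6)%N) : Pf n (g (inord n)).
  by have := hg (inord n); rewrite inordK.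
have gt_d n s (k l : 'I_4) : (n < 6)%N -> s \in face_ends (face_set n) ->
    face_gt n (m n) k l -> 0 < cdiff k l (ep s.1 s.2).
  move=> n6 hs; have [h1 _ _] := Pn n n6.
  have [_ {}h1] := h1 s hs.
  case/or3P => [/andP[kT lT]|/and3P[/eqP lm km kT]|/and3P[/eqP km lm lT]].
  - move: hs; rewrite inE => /andP[_ /asboolP/faceP]; apply; by rewrite inE.
  - have E : l = (g (inord n)).1 by apply: val_inj.
    have := h1 k; rewrite -E /tsg inE kT mul1r; apply.
    by apply: contraNneq km => ->; rewrite lm.
  - have E : k = (g (inord n)).1 by apply: val_inj.
    have := h1 l; rewrite -E /tsg inE (negbTE lT) mulN1r -cdiffN; apply.
    by apply: contraNneq lm => ->; rewrite km.
(* The swirls at the two ends travel [a] in opposite directions, while their arcs hit it from the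
   same side; hence they turn oppositely. Differences of coordinates other than [tau a] keep their
   sign along [a], which gives [face_link]. *)
have link a n n' : (n < 6)%N -> (n' < 6)%N -> (a, true) \in face_ends (face_set n) ->
    (a, false) \in face_ends (face_set n') ->
    c n != c n' /\ face_link n (m n) n' (m n') (tau a).
  move=> n6 n'6 h h'; split.
    have [_ _ h3] := Pn n n6; have [_ _ h3'] := Pn n' n'6.
    have [s hs hc] := h3 _ h; have [s' hs' hc'] := h3' _ h'.
    have [e e0 he] := @side_turn _ _ _ _ hitP (g (inord n)).2 s (a, true) (esym hs).
    have [e' e'0 he'] := @side_turn _ _ _ _ hitP (g (inord n')).2 s' (a, false) (esym hs').
    move: hc hc'; rewrite he he' (pmulr_rgt0 _ e0) (pmulr_rgt0 _ e'0) /side /back /front /= => hc hc'.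
    have := @one_sided s.1 s.2 s'.1 s'.2; rewrite hs hs' => /(_ erefl) hp.
    move: hc'; rewrite det3C12 /c.
    by case: (g (inord n)).2 hc; case: (g (inord n')).2; rewrite ?expr0 ?expr1 //; nra.
  have [/(_ _ h) [t1 _] _ _] := Pn n n6; have [/(_ _ h') [t2 _] _ _] := Pn n' n'6.
  move: (h) (h'); rewrite !inE /= /toward !inE.
  move=> /andP[/eqP/esym u1 _] /andP[/eqP/esym u2 _].
  apply/and5P; split; [exact: u1|by rewrite u2|exact: t1|exact: t2|].
  apply/allP => k; rewrite mem_iota => /andP[_ k4].
  apply/allP => l; rewrite mem_iota => /andP[_ l4].
  have [//|ka] := eqVneq k (tau a); have [//|la] := eqVneq l (tau a).
  apply/negP => /andP[].
  move/(gt_d n (a, true) (Ordinal k4) (Ordinal l4) n6 h) => /=.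
  rewrite cdiff_transfer //.
  move=> x1 /(gt_d n' (a, false) (Ordinal l4) (Ordinal k4) n'6 h') /=.
  by rewrite cdiffN; lra.
apply: (@no_bicolouring m c); first by move=> f; apply: ltn_ord.
move=> f i f6 i4 im.
have [_ h2 _] := Pn f f6.
have [s hs ts] : exists2 s, s \in face_ends (face_set f) & tau s.1 = Ordinal i4.
  by apply: h2; apply: contraNneq im => E; rewrite /m -E.
case: s hs ts => [a b] hs /= ta.
have bE : b = top f i by move: hs; rewrite inE /= => /andP[/eqP -> _]; rewrite /toward ta inE.
have [f' f'6 hf'] := nine_end (a, ~~ b).
exists f'; rewrite -bE; case: b {bE} hs hf' => hs hf'.
  by have [h1 h2'] := link a f f' f6 f'6 hs hf'; split=> //; rewrite ta in h2'.
have [h1 h2'] := link a f' f f'6 f6 hf' hs.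
by split; rewrite 1?eq_sym //; rewrite ta in h2'.
Qed.

End Nine.

End Faces.

(** * Coordinates defined by four poles in general position *)

Section Coordinates.
Variable R : realType.

Lemma linear_form_dot (g : vec R -> R) p : linear_form g ->
  g p = dot (g (1, 0, 0), g (0, 1, 0), g (0, 0, 1)) p.
Proof.
move=> hg; case: p => [[a b] c].
have -> : (a, b, c) = lin 1 (lin a (1, 0, 0) b (0, 1, 0)) c (0, 0, 1).
  by apply: vec_eqP; rewrite /lin /vx /vy /vz /=; ring.
by rewrite !hg /dot /lin /vx /vy /vz /=; ring.
Qed.

Lemma linear_form_det3 (g : vec R -> R) p q r u : linear_form g ->
  g p = 0 -> g q = 0 -> g r = 0 -> g u != 0 -> det3 p q r = 0.
Proof.
move=> hg hp hq hr hu; apply/eqP/negPn/negP => hd.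
rewrite (linear_form_dot p hg) in hp; rewrite (linear_form_dot q hg) in hq.
rewrite (linear_form_dot r hg) in hr; move: hu; rewrite (linear_form_dot u hg).
by rewrite (det3_dot0 hp hq hr hd) /dot /vx /vy /vz /= !mul0r !addr0 eqxx.
Qed.

(* The scalars [c i] are the coefficients of a linear relation between the
   four poles, so that [c i * P i] sum to zero. *)
Lemma pole_coordinates (P : 'I_4 -> vec R) :
  (forall m1 m2 m3, m1 <> m2 -> m1 <> m3 -> m2 <> m3 ->
     det3 (P m1) (P m2) (P m3) <> 0) ->
  exists (c : 'I_4 -> R) (x : 'I_4 -> vec R -> R),
    (forall k, linear_form (x k)) /\
    (forall i k l, c i * (x k (P i) - x l (P i)) = (i == k)%:R - (i == l)%:R).
Proof.
move=> hP.
pose i0 : 'I_4 := @Ordinal 4 0 isT; pose i1 : 'I_4 := @Ordinal 4 1 isT.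
pose i2 : 'I_4 := @Ordinal 4 2 isT; pose i3 : 'I_4 := @Ordinal 4 3 isT.
have ne (a b : 'I_4) : val a != val b -> a <> b by move=> h e; rewrite e eqxx in h.
have h0 : det3 (P i1) (P i2) (P i3) != 0 by apply/eqP; apply: hP; apply: ne.
have h1 : det3 (P i0) (P i2) (P i3) != 0 by apply/eqP; apply: hP; apply: ne.
have h2 : det3 (P i0) (P i1) (P i3) != 0 by apply/eqP; apply: hP; apply: ne.
have h3 : det3 (P i0) (P i1) (P i2) != 0 by apply/eqP; apply: hP; apply: ne.
pose c0 := det3 (P i1) (P i2) (P i3); pose c1 := - det3 (P i0) (P i2) (P i3).
pose c2 := det3 (P i0) (P i1) (P i3); pose c3 := - det3 (P i0) (P i1) (P i2).
(* Up to scaling, the basis dual to the first three poles; the last coordinate is set to zero, as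
   only differences matter. *)
pose x (k : 'I_4) p : R := nth 0 [:: det3 (P i1) (P i2) p / (- c3 * c0);
  det3 (P i2) (P i0) p / (- c3 * c1); det3 (P i0) (P i1) p / (- c3 * c2); 0] k.
pose c (k : 'I_4) : R := nth 0 [:: c0; c1; c2; c3] k.
exists c, x.
have key i k : c i * x k (P i) = (i == k)%:R - (i == i3)%:R.
  have E (j : 'I_4) : [\/ j = i0, j = i1, j = i2 | j = i3].
    by case: j => [[|[|[|[|//]]]] j4]; [constructor 1|constructor 2|constructor 3|constructor 4];
      apply: val_inj.
  have e0 : det3 (P i1) (P i2) (P i0) = det3 (P i0) (P i1) (P i2) by rewrite -det3rot.
  have e1 : det3 (P i2) (P i0) (P i1) = det3 (P i0) (P i1) (P i2) by rewrite det3rot.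
  have e2 : det3 (P i2) (P i0) (P i3) = - det3 (P i0) (P i2) (P i3) by rewrite det3C12.
  case: (E i) => ->; case: (E k) => ->; rewrite /c /x /c0 /c1 /c2 /c3 /=;
    rewrite ?det3ee1 ?det3ee2 ?e0 ?e1 ?e2 ?mul0r ?mulr0 ?subr0 ?subrr //;
    move: h0 h1 h2 h3; move: (det3 (P i0) (P i1) (P i2)) (det3 (P i0) (P i1) (P i3))
      (det3 (P i0) (P i2) (P i3)) (det3 (P i1) (P i2) (P i3)) => d3 d2 d1 d0 h0 h1 h2 h3;
    by field; rewrite ?h0 ?h1 ?h2 ?h3.
split=> [k s u t v|i k l]; last by rewrite mulrBr !key; ring.
rewrite /x; case: k => [[|[|[|[|//]]]] k4] /=; rewrite ?det3_linear; try by ring.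
Qed.

Lemma arc_towards (a : sarc R) (P : vec R) (c : R) : is_arc a -> on_sphere P -> c != 0 ->
  det3 a.1 a.2 P = 0 -> ~ in_arc P a -> ~ in_arc (vopp P) a ->
  exists up : bool, exists s t, [/\ 0 < s, 0 < t & forall g, linear_form g ->
    s * g (if up then a.2 else a.1) = t * g (if up then a.1 else a.2) + c * g P].
Proof.
move=> ha hP c0 hd n1 n2.
have [s [t hst]] := det3_span (gram_arc ha) hd.
have nst : ~ (0 <= s /\ 0 <= t) by case=> s0 t0; apply: n1; split=> //; exists s, t.
have nst' : ~ (s <= 0 /\ t <= 0).
  case=> s0 t0; apply: n2; split.
    by move: hP; rewrite /on_sphere /dot /vopp /vx /vy /vz /= !mulrNN.
  exists (- s), (- t); split; rewrite ?oppr_ge0 // hst.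
  by apply: vec_eqP; rewrite /lin /vopp /vx /vy /vz /=; ring.
have g_P g : linear_form g -> g P = s * g a.1 + t * g a.2 by move=> hg; rewrite hst hg.
have {c0} [c0|c0] : c < 0 \/ 0 < c by case: ltgtP c0 => // ? _; [left|right].
- have [t0|t0] := ltP 0 t.
    have s0 : s < 0 by rewrite ltNge; apply/negP => s0; apply: nst; split=> //; apply: ltW.
    exists false, (c * s), (- c * t); split; [nra|nra|] => g hg.
    by rewrite (g_P _ hg) /=; ring.
  have s0 : 0 < s by rewrite ltNge; apply/negP => s0; apply: nst'.
  have t1 : t < 0.
    by rewrite lt_neqAle t0 andbT; apply/eqP => t1; apply: nst; rewrite t1 (ltW s0).
  exists true, (c * t), (- c * s); split; [nra|nra|] => g hg.
  by rewrite (g_P _ hg) /=; ring.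
- have [t0|t0] := ltP 0 t.
    have s0 : s < 0 by rewrite ltNge; apply/negP => s0; apply: nst; split=> //; apply: ltW.
    exists true, (c * t), (- c * s); split; [nra|nra|] => g hg.
    by rewrite (g_P _ hg) /=; ring.
  have s0 : 0 < s by rewrite ltNge; apply/negP => s0; apply: nst'.
  have t1 : t < 0.
    by rewrite lt_neqAle t0 andbT; apply/eqP => t1; apply: nst; rewrite t1 (ltW s0).
  exists false, (c * s), (- c * t); split; [nra|nra|] => g hg.
  by rewrite (g_P _ hg) /=; ring.
Qed.

End Coordinates.

Lemma next_mkseq (T : eqType) (h : nat -> T) n :
  (forall i j, (i < n)%N -> (j < n)%N -> h i = h j -> i = j) -> h n = h 0%N ->
  forall i, (i < n)%N -> next (mkseq h n) (h i) = h i.+1.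
Proof.
move=> inj hn i hi.
have U : uniq (mkseq h n).
  by apply/mkseq_uniqP => a b; rewrite !inE; apply: inj.
have ix : index (h i) (mkseq h n) = i.
  by rewrite -(nth_mkseq (h i) h hi) index_uniq ?size_mkseq.
rewrite next_nth ix (_ : h i \in mkseq h n); last by rewrite -(nth_mkseq (h i) h hi) mem_nth ?size_mkseq.
case: n inj hn hi {U ix} => // n inj hn hi; rewrite /mkseq /= (iotaDl 1 0) -map_comp.
move: hi; rewrite ltnS leq_eqVlt => /predU1P[->|hi].
  by rewrite nth_default ?size_map ?size_iota.
by rewrite (nth_map 0%N) ?size_iota // nth_iota.
Qed.

(** * Lower bounds *)

Section LowerBounds.
Variables (R : realType) (I : finType) (D : I -> sarc R).
Hypothesis hSD : SD D.

Lemma SD_arc i : is_arc (D i). Proof. by case: hSD. Qed.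

Lemma cone2_nonzero (a : sarc R) p : is_arc a -> cone2 a.1 a.2 p -> 0 < dot p p.
Proof.
move=> /gram_arc ga [s [t [s0 t0 hp]]]; rewrite lt_neqAle dot_ge0 andbT.
apply/eqP => /esym/dot_eq0; rewrite hp => h.
have : lin s a.1 t a.2 = lin 0 a.1 0 a.2.
  by rewrite h; apply: vec_eqP; rewrite /lin /vx /vy /vz /=; ring.
by case/(lin_inj ga) => h1 _; rewrite h1 ltxx in s0.
Qed.

Lemma cone2_disjoint i j p : cone2 (D i).1 (D i).2 p -> cone2 (D j).1 (D j).2 p -> i = j.
Proof.
move=> hi hj; apply: contrapT => ij.
have p0 := cone2_nonzero (SD_arc i) hi.
case: hSD => _ _ /(_ i j ij (normalize p)) H _.
by apply: H; apply: in_relint_normalize.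
Qed.

Lemma in_relint_cone2 p (a : sarc R) : in_relint p a -> cone2 a.1 a.2 p.
Proof. by case=> _ [s [t [s0 t0 ->]]]; exists s, t. Qed.

Variable up : I -> bool.

(* For the lower bounds [up] is chosen so that [ep a true] is the end towards
   the pole of [a]. *)
Definition ep a b : vec R := if b == up a then (D a).2 else (D a).1.

Lemma ep_ends a b : ends (D a) (ep a b) (ep a (~~ b)).
Proof. by rewrite /ep; case: b (up a) => [] []; [right|left|left|right]. Qed.

Lemma ends_ep a e f : ends (D a) e f -> exists b, e = ep a b /\ f = ep a (~~ b).
Proof.
case=> -[-> ->]; [exists (~~ up a)|exists (up a)]; rewrite /ep; by case: (up a).
Qed.

Lemma cone2_ep a p : cone2 (ep a false) (ep a true) p <-> cone2 (D a).1 (D a).2 p.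
Proof. by rewrite /ep; case: (up a); split=> // /cone2C. Qed.

Lemma gram_pos a : 0 < gram (ep a false) (ep a true).
Proof. by have := gram_arc (SD_arc a); rewrite /ep; case: (up a); rewrite //= gramC. Qed.

Lemma ep_disjoint a a' p : on_arc ep a p -> on_arc ep a' p -> a = a'.
Proof. by move=> /cone2_ep h /cone2_ep; apply: cone2_disjoint h. Qed.

Variable nxt : I -> bool -> I.
Hypothesis nxtP : forall a b, in_relint (ep a b) (D (nxt a b)).

Lemma nxt_hit a b : on_arc ep (nxt a b) (ep a b).
Proof. by apply/cone2_ep/in_relint_cone2/nxtP. Qed.

Lemma relint_nxt a b j : in_relint (ep a b) (D j) -> j = nxt a b.
Proof.
by move/in_relint_cone2 => h; apply: (@cone2_disjoint _ _ (ep a b)) => //;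
  apply/in_relint_cone2/nxtP.
Qed.

(** An arc with both ends in another one would be coplanar with it. So the end by which an arc hits
    the next is determined, and the quantifiers in [turn_pos] and [turn_neg] range over one choice
    only. *)
Lemma relint_end a b b' j :
  in_relint (ep a b) (D j) -> in_relint (ep a b') (D j) -> b = b'.
Proof.
move=> h h'; have [//|bb] := eqVneq b b'.
have E : b' = ~~ b by case: b b' bb {h h'} => [] [].
have hj := relint_nxt h; rewrite hj E in h'.
have := transversal gram_pos nxt_hit ep_disjoint a b true.
move/in_relint_cone2/cone2_ep : h' => [s [t [_ _ ->]]].
by rewrite /= det3_linear det3ee1 det3ee2 !mulr0 addr0 eqxx.
Qed.

Section Swirl.
Variables (T : finType) (Q : pred T) (phi : T -> vec R -> R).

Definition walk_cycle sg x n : seq I := mkseq (fun i => (walk ep nxt sg x i).1) n.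

(** The second half records where the hit points lie: equal cycles coming from two faces would share
    a hit point, though the faces are disjoint. *)
Lemma trapped_swirlP sg x n : trapped_swirl ep nxt Q phi sg x n ->
  swirl D (walk_cycle sg x n) /\
  (forall a e f, a \in walk_cycle sg x n -> ends (D a) e f ->
     in_relint e (D (next (walk_cycle sg x n) a)) -> trap Q phi e).
Proof.
case=> n0 per inj tr; rewrite /walk_cycle.
set w := walk ep nxt sg x; pose h i := (w i).1.
have hn : h n = h 0%N by rewrite /h /w per.
have U : uniq (mkseq h n) by apply/mkseq_uniqP => a b; rewrite !inE; apply: inj.
have nx i : (i < n)%N -> next (mkseq h n) (h i) = h i.+1 by apply: next_mkseq.
have memP a : a \in mkseq h n -> exists2 i, (i < n)%N & a = h i.
  by case/mapP => i; rewrite mem_iota => /andP[_ hi] ->; exists i.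
have hit i : in_relint (ep (h i) (w i).2) (D (h i.+1)) by apply: nxtP.
have nx2 i : (i < n)%N -> next (mkseq h n) (h i.+1) = h i.+2.
  move=> hi; have [E|ne] := eqVneq i.+1 n; last by apply: nx; lia.
  by rewrite E hn nx // /h /w walkS (walkS _ _ _ _ n) per.
have turn i : (i < n)%N -> forall ex fx ey fy, ends (D (h i)) ex fx ->
   in_relint ex (D (h i.+1)) -> ends (D (h i.+1)) ey fy ->
   in_relint ey (D (h i.+2)) -> 0 < (-1) ^+ sg * det3 fx ex ey.
  move=> hi ex fx ey fy /ends_ep [b [-> ->]] h1 /ends_ep [b' [-> _]] h2.
  rewrite (relint_end h1 (hit i)) (relint_end h2 (hit i.+1)).
  exact: (side_step_front gram_pos nxt_hit ep_disjoint sg (w i)).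
split; last first.
  move=> a e f /memP [i hi ->]; rewrite nx // => /ends_ep [b [-> _]] h1.
  by rewrite (relint_end h1 (hit i)); apply: tr.
split; rewrite ?size_mkseq //.
- move=> a /memP [i hi ->]; rewrite nx //.
  by exists (ep (h i) (w i).2), (ep (h i) (~~ (w i).2)); split; [apply: ep_ends|].
- have [sgT|sgF] := boolP sg; [right|left] => a /memP [i hi ->];
    rewrite nx // nx2 // => ex fx ey fy h1 h2 h3 h4;
    have := turn i hi ex fx ey fy h1 h2 h3 h4.
    by rewrite sgT expr1 mulN1r oppr_gt0.
  by rewrite (negbTE sgF) expr0 mul1r.
Qed.

End Swirl.

Section Types.
Variables (tau : I -> 'I_4) (x : 'I_4 -> vec R -> R).
Hypothesis x_linear : forall k, linear_form (x k).
Hypothesis moveP : forall a, exists s t, [/\ 0 < s, 0 < t & forall k l,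
  s * cdiff x k l (ep a true) = t * cdiff x k l (ep a false)
    + ((tau a == k)%:R - (tau a == l)%:R)].
Hypothesis planeP : forall k l, k != l -> forall p q r,
  cdiff x k l p = 0 -> cdiff x k l q = 0 -> cdiff x k l r = 0 -> det3 p q r = 0.

Lemma I_inhabited : exists a : I, true.
Proof. by case: hSD => /card_gt0P [a _] _ _ _; exists a. Qed.

Lemma six_swirls : at_least_swirls D 6.
Proof.
have hf (f : 'I_6) : exists s, swirl D s /\ forall a e g, a \in s -> ends (D a) e g ->
    in_relint e (D (next s a)) -> face x (face_set f) e.
  have [sg [y [n hs]]] := face_swirl gram_pos nxt_hit ep_disjoint x_linear moveP planeP
    I_inhabited (fT_in (ltn_ord f)) (fT_notin (ltn_ord f)).
  by exists (walk_cycle sg y n); apply: trapped_swirlP hs.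
have [s hs] := choice hf.
exists (mkseq (fun i => s (inord i)) 6); split; first by rewrite size_mkseq.
split; first by move=> t /mapP [i _ ->]; case: (hs (inord i)).
rewrite size_mkseq => a b a6 b6 ab [n]; rewrite !nth_mkseq // => E.
have [[s0 U hit _] Fa] := hs (inord a); have [_ Fb] := hs (inord b).
case: (s (inord a)) s0 U hit Fa E => // c s' _ U hit Fa E.
have cs : c \in c :: s' by rewrite mem_head.
have [e [f [hef he]]] := hit c cs.
have h1 := Fa c e f cs hef he.
have h2 : face x (face_set (inord b : 'I_6)) e.
  by apply: (Fb c e f _ hef); rewrite E ?mem_rot // next_rot.
rewrite !inordK // in h1 h2.
exact: ab (face_disjoint a6 b6 h1 h2).
Qed.

Lemma ge_nine_arcs : (9 <= #|I|)%N.
Proof.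
exact: (nine_arcs gram_pos nxt_hit ep_disjoint x_linear moveP planeP I_inhabited).
Qed.

Lemma SOD_not_nine : same_side_hits D -> #|I| = 9%N -> False.
Proof.
move=> hs I9.
apply: (nine_not_one_sided gram_pos nxt_hit ep_disjoint x_linear moveP planeP
  I_inhabited I9) => a b a' b' E.
have h := hs a a' (nxt a b) _ _ _ _ (ep_ends a b) (nxtP a b) (ep_ends a' b').
have := h; rewrite {1}E => /(_ (nxtP a' b')).
rewrite /ep; case: (up (nxt a b)) => //=.
by rewrite ![det3 (D _).2 (D _).1 _]det3C12 mulrNN.
Qed.

End Types.
End LowerBounds.

Theorem SD_lower_bounds (R : realType) (I : finType) (D : I -> sarc R) :
  SD D -> nondeg_oriented D 4 ->
  [/\ at_least_swirls D 6, (9 <= #|I|)%N & SOD D -> (10 <= #|I|)%N].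
Proof.
move=> hSD [P [tau [Psph _ _ hf hP]]].
have [c [x [xl hx]]] := pole_coordinates hP.
have c0 i : c i != 0.
  pose j : 'I_4 := if i == ord0 then ord_max else ord0.
  have ij : i != j by rewrite /j; have [e|//] := eqVneq i ord0; rewrite e.
  apply/eqP => ci; have := hx i i j; rewrite ci mul0r eqxx (negbTE ij) subr0.
  by move/eqP; rewrite eq_sym oner_eq0.
have hup a : exists up : bool, exists s t, [/\ 0 < s, 0 < t & forall g, linear_form g ->
    s * g (if up then (D a).2 else (D a).1) = t * g (if up then (D a).1 else (D a).2)
      + c (tau a) * g (P (tau a))].
  by have [h1 h2 h3] := hf a; apply: arc_towards => //; apply: SD_arc.
have [up hu] := choice hup.
have hn (s : I * bool) : exists j, in_relint (ep D up s.1 s.2) (D j).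
  by case: hSD => _ _ _ /(_ s.1) [h1 h2]; rewrite /ep; case: ifP.
have [nx hnx] := choice hn.
pose nxt a b := nx (a, b).
have nxtP a b : in_relint (ep D up a b) (D (nxt a b)) := hnx (a, b).
have moveP a : exists s t, [/\ 0 < s, 0 < t & forall k l,
    s * cdiff x k l (ep D up a true) = t * cdiff x k l (ep D up a false)
      + ((tau a == k)%:R - (tau a == l)%:R)].
  have [s [t [s0 t0 h]]] := hu a; exists s, t; split=> // k l.
  have := h (cdiff x k l) (linear_formB (xl k) (xl l)); rewrite /cdiff hx => h'.
  by rewrite /ep; case: (up a) h'.
have planeP k l : k != l -> forall p q r,
    cdiff x k l p = 0 -> cdiff x k l q = 0 -> cdiff x k l r = 0 -> det3 p q r = 0.
  move=> kl p q r hp hq hr; apply: (linear_form_det3 (u := P k) _ hp hq hr).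
    exact: linear_formB.
  apply/eqP => h0; have := hx k k l; rewrite -/(cdiff x k l _) h0 mulr0 eqxx (negbTE kl) subr0.
  by move/eqP; rewrite eq_sym oner_eq0.
have g9 := ge_nine_arcs hSD nxtP xl moveP planeP.
split=> //; first exact: (six_swirls hSD nxtP xl moveP planeP).
case=> _ hs; rewrite ltn_neqAle g9 andbT; apply/eqP => /esym I9.
exact: (SOD_not_nine hSD nxtP xl moveP planeP hs I9).
Qed.

(** * Examples with integer endpoints *)

Section Scaling.
Variable R : realType.
Implicit Types u v w p : vec R.

Definition scl (k : R) u : vec R := lin k u 0 u.

Lemma normalizeE u : 0 < dot u u -> exists2 k, 0 < k & normalize u = scl k u.
Proof. by move=> u0; exists (Num.sqrt (dot u u))^-1; rewrite ?invr_gt0 ?sqrtr_gt0. Qed.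

Lemma det3_scl a b c u v w :
  det3 (scl a u) (scl b v) (scl c w) = a * b * c * det3 u v w.
Proof. by rewrite /det3 /scl /lin /vx /vy /vz /=; ring. Qed.

Lemma gram_scl a b u v : gram (scl a u) (scl b v) = (a * b) ^+ 2 * gram u v.
Proof. by rewrite /gram /dot /scl /lin /vx /vy /vz /=; ring. Qed.

Lemma gram_gt0_l u v : 0 < gram u v -> 0 < dot u u.
Proof.
move=> g0; rewrite lt_neqAle dot_ge0 andbT; apply/eqP => /esym/dot_eq0 u0.
by move: g0; rewrite u0 /gram /dot /vx /vy /vz /= !mul0r !addr0 expr0n mul0r subr0 ltxx.
Qed.

Lemma gram_gt0_r u v : 0 < gram u v -> 0 < dot v v.
Proof. by rewrite gramC; apply: gram_gt0_l. Qed.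

Lemma lin_scl s a u t b v : lin s (scl a u) t (scl b v) = lin (s * a) u (t * b) v.
Proof. by apply: vec_eqP; rewrite /scl /lin /vx /vy /vz /=; ring. Qed.

Lemma cone2_scl a b c u v p : 0 < a -> 0 < b -> 0 < c ->
  cone2 (scl a u) (scl b v) (scl c p) <-> cone2 u v p.
Proof.
move=> a0 b0 c0; split=> -[s [t [s0 t0 h]]].
  exists (s * a / c), (t * b / c); split; rewrite ?divr_gt0 ?mulr_gt0 //.
  have := congr1 (scl c^-1) h; rewrite lin_scl.
  have -> : scl c^-1 (scl c p) = p.
    by apply: vec_eqP; rewrite /scl /lin /vx /vy /vz /=; field; rewrite lt0r_neq0.
  by move=> ->; apply: vec_eqP; rewrite /scl /lin /vx /vy /vz /=; field; rewrite lt0r_neq0.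
exists (c * s / a), (c * t / b); split; rewrite ?divr_gt0 ?mulr_gt0 //.
rewrite lin_scl !divfK ?lt0r_neq0 // h.
by apply: vec_eqP; rewrite /scl /lin /vx /vy /vz /=; ring.
Qed.

Lemma gram_neq u v : on_sphere u -> on_sphere v -> 0 < gram u v ->
  u <> v /\ u <> vopp v.
Proof.
move=> hu hv; rewrite /gram hu hv => g0; split=> h.
  by move: g0; rewrite h hv expr1n mulr1 subrr ltxx.
have E : dot u v = -1.
  by rewrite h -hv /dot /vopp /vx /vy /vz /=; ring.
by move: g0; rewrite E sqrrN expr1n mulr1 subrr ltxx.
Qed.

Lemma normalize_gram u v : 0 < gram u v -> 0 < gram (normalize u) (normalize v).
Proof.
move=> g0; have [a a0 ->] := normalizeE (gram_gt0_l g0).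
have [b b0 ->] := normalizeE (gram_gt0_r g0).
by rewrite gram_scl mulr_gt0 // exprn_gt0 // mulr_gt0.
Qed.

Lemma normalize_arc u v : 0 < gram u v -> is_arc (normalize u, normalize v).
Proof.
move=> g0; have hu := normalize_sphere (gram_gt0_l g0).
have hv := normalize_sphere (gram_gt0_r g0).
by have [h1 h2] := gram_neq hu hv (normalize_gram g0); split.
Qed.

Lemma cone2_coef u v p : 0 < gram u v -> det3 u v p = 0 ->
  0 < dot p u * dot v v - dot p v * dot u v ->
  0 < dot p v * dot u u - dot p u * dot u v -> cone2 u v p.
Proof.
move=> g0 /(det3_span g0) [s [t hp]]; rewrite hp !dot_linearl => hs ht; exists s, t.
have E : dot v u = dot u v by rewrite /dot; ring.
split=> //.
  rewrite -(pmulr_lgt0 _ g0); move: hs; congr (0 < _); rewrite E /gram; ring.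
rewrite -(pmulr_lgt0 _ g0); move: ht; congr (0 < _); rewrite E /gram; ring.
Qed.

Definition opp_signs (a b : R) : Prop := a * b < 0 \/ (a = 0 /\ b = 0).

(* Expanding det3 (p, e, e') for a common point p and endpoints e, e' of the
   two arcs gives these sign conditions. *)
Lemma cone2_meet u v u' v' p : cone2 u v p -> cone2 u' v' p ->
  let a := det3 u' v' u in let b := det3 u' v' v in
  let a' := det3 u v u' in let b' := det3 u v v' in
  [/\ opp_signs a a', opp_signs b b', opp_signs a (- b') & opp_signs b (- a')].
Proof.
have opp s t x y : 0 < s -> 0 < t -> s * x + t * y = 0 -> opp_signs x y.
  move=> s0 t0 h; have [x0|x0|x0] := ltgtP x 0; last right.
  - by left; have : 0 < t * y; [nra|rewrite pmulr_rgt0 // => y0; nra].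
  - by left; have : t * y < 0; [nra|rewrite pmulr_rlt0 // => y0; nra].
  - by move: h; rewrite x0 mulr0 add0r => /eqP; rewrite mulf_eq0 gt_eqF //= => /eqP.
move=> [s [t [s0 t0 h]]] [s' [t' [s'0 t'0 h']]] a b a' b'.
have E : lin s u t v = lin s' u' t' v' by rewrite -h.
have Dl w1 w2 : det3 (lin s u t v) w1 w2 = s * det3 u w1 w2 + t * det3 v w1 w2.
  by rewrite /det3 /lin /vx /vy /vz /=; ring.
have Dl' w1 w2 : det3 (lin s' u' t' v') w1 w2 = s' * det3 u' w1 w2 + t' * det3 v' w1 w2.
  by rewrite /det3 /lin /vx /vy /vz /=; ring.
split.
- apply: (opp t' t) => //; have := Dl u u'; rewrite E Dl' /a /a' /det3; nra.
- apply: (opp s' s) => //; have := Dl v v'; rewrite E Dl' /b /b' /det3; nra.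
- apply: (opp s' t) => //; have := Dl u v'; rewrite E Dl' /a /b' /det3; nra.
- apply: (opp t' s) => //; have := Dl v u'; rewrite E Dl' /b /a' /det3; nra.
Qed.

End Scaling.

(** * Integer certificates for cones, signs and disjointness *)

Section IntegerVectors.
Variable R : realType.

Definition zr (n : Z) : R := (int_of_Z n)%:~R.

Lemma zrD a b : zr (Z.add a b) = zr a + zr b.
Proof. by rewrite /zr -intrD; congr intmul; apply: (rmorphD int_of_Z a b). Qed.
Lemma zrM a b : zr (Z.mul a b) = zr a * zr b.
Proof. by rewrite /zr -intrM; congr intmul; apply: (rmorphM int_of_Z a b). Qed.
Lemma zrN a : zr (Z.opp a) = - zr a.
Proof. by rewrite /zr -mulrNz; congr intmul; apply: (rmorphN int_of_Z a). Qed.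
Lemma zrB a b : zr (Z.sub a b) = zr a - zr b.
Proof. by rewrite -zrN -zrD. Qed.

Lemma zr_gt0 a : (0 < zr a) = Z.ltb 0 a.
Proof.
rewrite /zr ltr0z; case: a => //= p.
by rewrite ltz_nat; have := Pos2Nat.is_pos p; lia.
Qed.

Lemma zr_lt0 a : (zr a < 0) = Z.ltb a 0.
Proof. by rewrite -oppr_gt0 -zrN zr_gt0; apply/idP/idP; lia. Qed.

Lemma zr_eq0 a : (zr a == 0) = Z.eqb a 0.
Proof. by have := zr_gt0 a; have := zr_lt0 a; case: ltgtP; lia. Qed.

Definition zvec := (Z * Z * Z)%type.
Definition zdot (u v : zvec) : Z :=
  (u.1.1 * v.1.1 + u.1.2 * v.1.2 + u.2 * v.2)%ZZ.
Definition zdet (u v w : zvec) : Z :=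
  (u.1.1 * (v.1.2 * w.2 - v.2 * w.1.2) - u.1.2 * (v.1.1 * w.2 - v.2 * w.1.1)
   + u.2 * (v.1.1 * w.1.2 - v.1.2 * w.1.1))%ZZ.
Definition zgram u v : Z := (zdot u u * zdot v v - zdot u v * zdot u v)%ZZ.
Definition emb (u : zvec) : vec R := (zr u.1.1, zr u.1.2, zr u.2).

Lemma dot_emb u v : dot (emb u) (emb v) = zr (zdot u v).
Proof. by rewrite /dot /zdot /vx /vy /vz /= !(zrD, zrM). Qed.
Lemma det3_emb u v w : det3 (emb u) (emb v) (emb w) = zr (zdet u v w).
Proof. by rewrite /det3 /zdet /vx /vy /vz /= !(zrD, zrB, zrM). Qed.
Lemma gram_emb u v : gram (emb u) (emb v) = zr (zgram u v).
Proof. by rewrite /zgram zrB !zrM /gram !dot_emb expr2. Qed.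

(* Coefficients of [p] in the basis [u, v] of a plane containing it, up to the
   common positive factor [zgram u v]. *)
Definition zcoef1 u v p : Z := (zdot p u * zdot v v - zdot p v * zdot u v)%ZZ.
Definition zcoef2 u v p : Z := (zdot p v * zdot u u - zdot p u * zdot u v)%ZZ.

Definition zcone u v p : bool :=
  [&& Z.eqb (zdet u v p) 0, Z.ltb 0 (zcoef1 u v p) & Z.ltb 0 (zcoef2 u v p)].

Lemma zconeP u v p : Z.ltb 0 (zgram u v) -> zcone u v p ->
  cone2 (emb u) (emb v) (emb p).
Proof.
rewrite -zr_gt0 -gram_emb => g0 /and3P[].
rewrite -zr_eq0 -det3_emb => /eqP d0; rewrite -!zr_gt0 !zrB !zrM -!dot_emb => h1 h2.
exact: cone2_coef.
Qed.

Definition zopp a b : bool := Z.ltb (Z.mul a b) 0 || (Z.eqb a 0 && Z.eqb b 0).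
(** A necessary condition for the two open arcs to meet; disjointness is certified by its
    failure. *)
Definition zmeet u v u' v' : bool :=
  let a := zdet u' v' u in let b := zdet u' v' v in
  let a' := zdet u v u' in let b' := zdet u v v' in
  [&& zopp a a', zopp b b', zopp a (Z.opp b') & zopp b (Z.opp a')].

Lemma zoppP a b : opp_signs (zr a) (zr b) -> zopp a b.
Proof.
case=> [|[/eqP ha /eqP hb]]; rewrite /zopp; first by rewrite -zrM zr_lt0 => ->.
by move: ha hb; rewrite !zr_eq0 => -> ->; rewrite orbT.
Qed.

Lemma zmeetP u v u' v' p : cone2 (emb u) (emb v) p -> cone2 (emb u') (emb v') p ->
  zmeet u v u' v'.
Proof.
move=> h h'; have := cone2_meet h h'; rewrite /= !det3_emb -!zrN => -[h1 h2 h3 h4].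
by apply/and4P; split; apply: zoppP.
Qed.

Lemma zcoef_lin u v p (s t : R) : emb p = lin s (emb u) t (emb v) ->
  zr (zcoef1 u v p) = s * gram (emb u) (emb v) /\
  zr (zcoef2 u v p) = t * gram (emb u) (emb v).
Proof.
move=> hp; rewrite /zcoef1 /zcoef2 !zrB !zrM -!dot_emb hp !dot_linearl.
have -> : dot (emb v) (emb u) = dot (emb u) (emb v) by rewrite /dot; ring.
by rewrite /gram; split; ring.
Qed.

End IntegerVectors.

Lemma swirl_traject (T : eqType) (s : seq T) x0 : uniq s -> head x0 s \in s ->
  s = traject (next s) (head x0 s) (size s) /\
  iter (size s) (next s) (head x0 s) = head x0 s.
Proof.
case: s => // x s U _; have := cycle_next U; set f := next _ => /= hc.
have := fpathE hc; rewrite size_rcons => E.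
have E2 : traject f x (size s).+2 = x :: rcons s x by rewrite trajectS E.
rewrite trajectSr -rcons_cons in E2.
by case: (rcons_inj E2) => e1 e2; split; rewrite /= ?e1.
Qed.

(** * Verification of a diagram given by integer data *)

Section Example.
Variables (R : realType) (n : nat).
Variables (zends : seq (zvec * zvec)) (zhits : seq (nat * nat)).
Variables (zpoles : seq zvec) (ztypes : seq nat).
(* A cycle is given by its direction, an initial state and its length. *)
Variable zcycles : seq (bool * (nat * bool) * nat).

Definition zend i (b : bool) : zvec :=
  let e := nth ((0, 0, 0), (0, 0, 0))%ZZ zends i in if b then e.2 else e.1.
Definition zhit i (b : bool) : nat :=
  let h := nth (0, 0)%N zhits i in if b then h.2 else h.1.
Definition zpole m : zvec := nth (0, 0, 0)%ZZ zpoles m.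
Definition ztype i : nat := nth 0%N ztypes i.

Definition check_SD : bool :=
  all (fun i => [&& Z.ltb 0 (zgram (zend i false) (zend i true)),
    all (fun b => (zhit i b < n.+1)%N && zcone (zend (zhit i b) false)
      (zend (zhit i b) true) (zend i b)) [:: true; false]
    & all (fun j => (i == j) || ~~ zmeet (zend i false) (zend i true)
        (zend j false) (zend j true)) (iota 0 n.+1)]) (iota 0 n.+1).

Definition check_poles : bool :=
  all (fun m1 => all (fun m2 => (m1 == m2) ||
    (Z.ltb 0 (zgram (zpole m1) (zpole m2)) &&
     all (fun m3 => [|| m1 == m3, m2 == m3 |
       ~~ Z.eqb (zdet (zpole m1) (zpole m2) (zpole m3)) 0]) (iota 0 4)))
    (iota 0 4)) (iota 0 4).

(** The pole is in the plane of the arc with coefficients of opposite signs, so neither it nor its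
    antipode is in the arc. *)
Definition check_types : bool :=
  all (fun i => let u := zend i false in let v := zend i true in
    let p := zpole (ztype i) in
    [&& (ztype i < 4)%N, Z.eqb (zdet u v p) 0
      & Z.ltb (Z.mul (zcoef1 u v p) (zcoef2 u v p)) 0]) (iota 0 n.+1).

Definition check_one_sided : bool :=
  all (fun i => all (fun b => all (fun i' => all (fun b' =>
    (zhit i b != zhit i' b') ||
    Z.ltb 0 (Z.mul
      (zdet (zend (zhit i b) false) (zend (zhit i b) true) (zend i (~~ b)))
      (zdet (zend (zhit i b) false) (zend (zhit i b) true) (zend i' (~~ b')))))
    [:: true; false]) (iota 0 n.+1)) [:: true; false]) (iota 0 n.+1).

Definition zstep (sg : bool) (x : nat * bool) : nat * bool :=
  let y := zhit x.1 x.2 in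
  let z := zdet (zend x.1 (~~ x.2)) (zend x.1 x.2) (zend y true) in
  (y, if sg then Z.ltb z 0 else Z.ltb 0 z).

Definition zcycle sg x m : seq nat := mkseq (fun i => (iter i (zstep sg) x).1) m.

Definition is_zcycle sg x m : bool :=
  [&& (0 < m)%N, iter m (zstep sg) x == x & uniq (zcycle sg x m)].

Definition zcycle_of (c : bool * (nat * bool) * nat) : seq nat :=
  zcycle c.1.1 c.1.2 c.2.

(** The third clause makes the list complete: every closed walk with distinct arcs, in either
    direction, is a rotation of a listed cycle. Lengths stop at [n.+1], the number of arcs. *)
Definition check_cycles : bool :=
  [&& all (fun c => is_zcycle c.1.1 c.1.2 c.2 && (c.1.2.1 < n.+1)%N) zcycles,
      pairwise (fun c c' => ~~ perm_eq (zcycle_of c) (zcycle_of c')) zcycles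
    & all (fun sg => all (fun i => all (fun b => all (fun m =>
        ~~ is_zcycle sg (i, b) m ||
        has (fun c => has (fun r => rot r (zcycle_of c) == zcycle sg (i, b) m)
          (iota 0 n.+2)) zcycles)
      (iota 0 n.+2)) [:: true; false]) (iota 0 n.+1)) [:: true; false]].

Hypothesis hSD : check_SD.

Definition zarc (i : 'I_n.+1) : sarc R :=
  (normalize (emb R (zend i false)), normalize (emb R (zend i true))).

Let mem_ord (i : 'I_n.+1) : val i \in iota 0 n.+1.
Proof. by rewrite mem_iota ltn_ord. Qed.

Let mem_bool (b : bool) : b \in [:: true; false]. Proof. by case: b. Qed.

Lemma zgram_gt0 (i : 'I_n.+1) : 0 < gram (emb R (zend i false)) (emb R (zend i true)).
Proof. by have /allP/(_ _ (mem_ord i))/and3P[h _ _] := hSD; rewrite gram_emb zr_gt0. Qed.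

Definition nxtz (i : 'I_n.+1) b : 'I_n.+1 := inord (zhit i b).

Lemma zhit_lt (i : 'I_n.+1) b : (zhit i b < n.+1)%N.
Proof.
by have /allP/(_ _ (mem_ord i))/and3P[_ /allP/(_ _ (mem_bool b))/andP[]] := hSD.
Qed.

Lemma val_nxtz i b : val (nxtz i b) = zhit i b.
Proof. by rewrite /nxtz /= inordK // zhit_lt. Qed.

Lemma zhit_cone (i : 'I_n.+1) b : cone2 (emb R (zend (nxtz i b) false))
  (emb R (zend (nxtz i b) true)) (emb R (zend i b)).
Proof.
apply: zconeP; first by rewrite -(zr_gt0 R) -gram_emb zgram_gt0.
rewrite -[nat_of_ord _]/(val _) val_nxtz.
by have /allP/(_ _ (mem_ord i))/and3P[_ /allP/(_ _ (mem_bool b))/andP[]] := hSD.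
Qed.

Lemma zend_gt0 (i : 'I_n.+1) b : 0 < dot (emb R (zend i b)) (emb R (zend i b)).
Proof. by case: b; [apply: gram_gt0_r|apply: gram_gt0_l]; apply: zgram_gt0. Qed.

Lemma zarc_cone (i : 'I_n.+1) p :
  cone2 (zarc i).1 (zarc i).2 p <-> cone2 (emb R (zend i false)) (emb R (zend i true)) p.
Proof.
have [a a0 Ea] := normalizeE (zend_gt0 i false).
have [b b0 Eb] := normalizeE (zend_gt0 i true).
rewrite /zarc /= Ea Eb -[in X in X <-> _](_ : scl 1 p = p); first exact: cone2_scl.
by apply: vec_eqP; rewrite /scl /lin /vx /vy /vz /=; ring.
Qed.

Local Notation ept := (ep zarc (fun _ => true)).

Lemma ept_normalize i b : ept i b = normalize (emb R (zend i b)).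
Proof. by rewrite /ep; case: b. Qed.

Lemma nxtzP i b : in_relint (ept i b) (zarc (nxtz i b)).
Proof.
rewrite ept_normalize; apply: in_relint_normalize; first exact: zend_gt0.
by apply/zarc_cone/zhit_cone.
Qed.

Lemma zarc_SD : SD zarc.
Proof.
split.
- by rewrite card_ord.
- by move=> i; apply/normalize_arc/zgram_gt0.
- move=> i j ij p /in_relint_cone2/zarc_cone hi /in_relint_cone2/zarc_cone hj.
  have := zmeetP hi hj.
  have /allP/(_ _ (mem_ord i))/and3P[_ _ /allP/(_ _ (mem_ord j))/orP[/eqP e|/negP //]] := hSD.
  by case: ij; apply: val_inj.
- move=> i; split; [exists (nxtz i false)|exists (nxtz i true)].
    exact: (nxtzP i false).
  exact: (nxtzP i true).
Qed.

Lemma zarc_one_sided : check_one_sided -> SOD zarc.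
Proof.
move=> ho; split; first exact: zarc_SD.
move=> i i' j e f e' f' /(ends_ep (fun=> true)) [b [-> ->]] /(relint_nxt zarc_SD nxtzP) hj.
move=> /(ends_ep (fun=> true)) [b' [-> ->]] /(relint_nxt zarc_SD nxtzP) hj'.
have E : zhit i' b' = zhit i b by rewrite -!val_nxtz -hj -hj'.
have /allP/(_ _ (mem_ord i))/allP/(_ _ (mem_bool b))/allP/(_ _ (mem_ord i'))
  /allP/(_ _ (mem_bool b')) := ho.
rewrite E eqxx /= -(zr_gt0 R) zrM -!det3_emb -!val_nxtz -hj !ept_normalize /zarc /=.
have [a a0 ->] := normalizeE (zend_gt0 j false).
have [c c0 ->] := normalizeE (zend_gt0 j true).
have [k k0 ->] := normalizeE (zend_gt0 i (~~ b)).
have [l l0 ->] := normalizeE (zend_gt0 i' (~~ b')).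
rewrite !det3_scl => h; rewrite mulrACA mulr_gt0 //.
by rewrite !mulr_gt0.
Qed.

Lemma zarc_oriented : check_poles -> check_types -> nondeg_oriented zarc 4.
Proof.
move=> hp ht.
have m4 (m : 'I_4) : val m \in iota 0 4 by rewrite mem_iota ltn_ord.
have g0 (m m' : 'I_4) : m <> m' -> 0 < gram (emb R (zpole m)) (emb R (zpole m')).
  move=> mm; have /allP/(_ _ (m4 m))/allP/(_ _ (m4 m'))/orP[/eqP/val_inj//|/andP[h _]] := hp.
  by rewrite gram_emb zr_gt0.
have dp (m : 'I_4) : 0 < dot (emb R (zpole m)) (emb R (zpole m)).
  have [E|/eqP E] := eqVneq m ord0; last exact: gram_gt0_l (g0 _ _ E).
  by apply: (gram_gt0_l (g0 m ord_max _)); rewrite E.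
have tl (i : 'I_n.+1) : (ztype i < 4)%N.
  by have /allP/(_ _ (mem_ord i))/and3P[] := ht.
pose P (m : 'I_4) := normalize (emb R (zpole m)).
have Psph m : on_sphere (P m) by apply: normalize_sphere.
have Pne m m' : m <> m' -> P m <> P m' /\ P m <> vopp (P m').
  by move=> mm; apply: gram_neq => //; apply/normalize_gram/g0.
exists P, (fun i : 'I_n.+1 => Ordinal (tl i)); split=> //.
- by move=> m m' E; apply: contrapT => /Pne [].
- by move=> m m' /Pne [].
- move=> i; have /allP/(_ _ (mem_ord i))/and3P[_] := ht.
  rewrite -(zr_eq0 R) -det3_emb -(zr_lt0 R) zrM => /eqP d0 hlt.
  have [s [t hst]] := det3_span (zgram_gt0 i) d0.
  have [e1 e2] := zcoef_lin hst; rewrite e1 e2 in hlt.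
  have {hlt e1 e2} st : s * t < 0.
    have := zgram_gt0 i; move: hlt; set g := gram _ _ => hlt gg.
    by rewrite -(pmulr_llt0 _ (mulr_gt0 gg gg)); move: hlt; congr (_ < 0); ring.
  have [a a0 Ea] := normalizeE (zend_gt0 i false).
  have [b b0 Eb] := normalizeE (zend_gt0 i true).
  have [k k0 Ek] := normalizeE (dp (Ordinal (tl i))).
  have no (e s' t' : R) : e != 0 -> 0 <= s' -> 0 <= t' ->
      scl e (emb R (zpole (ztype i))) = lin s' (zarc i).1 t' (zarc i).2 -> False.
    move=> e0 s'0 t'0; rewrite /zarc /= Ea Eb lin_scl hst /scl.
    have -> : lin e (lin s (emb R (zend i false)) t (emb R (zend i true))) 0
        (lin s (emb R (zend i false)) t (emb R (zend i true)))
      = lin (e * s) (emb R (zend i false)) (e * t) (emb R (zend i true)).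
      by rewrite lin_lin !mul0r !addr0.
    case/(lin_inj (zgram_gt0 i)) => h1 h2.
    have : 0 <= (e * s) * (e * t) by rewrite h1 h2 !mulr_ge0 // ltW.
    rewrite mulrACA -expr2 pmulr_rge0 ?exprn_even_gt0 ?e0 ?orbT //.
    by rewrite leNgt st.
  split.
  + by rewrite /P /zarc /= Ea Eb Ek det3_scl d0 mulr0.
  + case=> _ [s' [t' [s0 t0]]]; rewrite /P Ek; apply: no => //; exact: lt0r_neq0.
  + case=> _ [s' [t' [s0 t0 h]]]; apply: (no (- k) s' t') => //.
      by rewrite oppr_eq0 lt0r_neq0.
    by rewrite -h /P Ek; apply: vec_eqP; rewrite /scl /lin /vopp /vx /vy /vz /=; ring.
- move=> m1 m2 m3 m12 m13 m23.
  have /allP/(_ _ (m4 m1))/allP/(_ _ (m4 m2))/orP[/eqP/val_inj//|/andP[_]] := hp.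
  move=> /allP/(_ _ (m4 m3))/or3P[/eqP/val_inj//|/eqP/val_inj//|].
  rewrite -(zr_eq0 R) -det3_emb /P => d0.
  have [a a0 ->] := normalizeE (dp m1); have [b b0 ->] := normalizeE (dp m2).
  have [c c0 ->] := normalizeE (dp m3).
  by rewrite det3_scl; apply/eqP; rewrite mulf_neq0 // lt0r_neq0 // !mulr_gt0.
Qed.

Local Notation stepR := (step ept nxtz).
Local Notation walkR := (walk ept nxtz).
Local Notation walk_cycleR := (walk_cycle zarc (fun _ => true) nxtz).

Definition zstate (x : 'I_n.+1 * bool) : nat * bool := (val x.1, x.2).

Lemma zstate_step sg x : zstate (stepR sg x) = zstep sg (zstate x).
Proof.
suff key : (0 < side ept sg x (ept (nxtz x.1 x.2) true)) =
    (let z := zdet (zend x.1 (~~ x.2)) (zend x.1 x.2) (zend (zhit x.1 x.2) true) in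
     if sg then Z.ltb z 0 else Z.ltb 0 z).
  exact: (congr2 pair (val_nxtz _ _) key).
rewrite /side /back /front !ept_normalize -val_nxtz.
have [a a0 ->] := normalizeE (zend_gt0 x.1 (~~ x.2)).
have [b b0 ->] := normalizeE (zend_gt0 x.1 x.2).
have [c c0 ->] := normalizeE (zend_gt0 (nxtz x.1 x.2) true).
have abc : 0 < a * b * c by rewrite !mulr_gt0.
rewrite det3_scl det3_emb mulrCA (pmulr_rgt0 _ abc).
by case: sg; rewrite ?expr1 ?expr0 ?mulN1r ?mul1r ?oppr_gt0 ?zr_gt0 ?zr_lt0.
Qed.

Lemma zstate_walk sg x t : zstate (walkR sg x t) = iter t (zstep sg) (zstate x).
Proof. by elim: t => //= t IH; rewrite zstate_step IH. Qed.

Lemma zstate_inj : injective zstate.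
Proof. by move=> [a b] [a' b'] [/ord_inj -> ->]. Qed.

Lemma zcycle_map sg x m : map val (walk_cycleR sg x m) = zcycle sg (zstate x) m.
Proof.
by rewrite /walk_cycle /zcycle /mkseq -map_comp; apply: eq_map => i /=;
  rewrite -zstate_walk.
Qed.

Lemma is_zcycle_swirl sg x m : is_zcycle sg (zstate x) m ->
  swirl zarc (walk_cycleR sg x m).
Proof.
case/and3P => m0 /eqP per U.
(* The empty family of forms makes the whole space the trap. *)
have ts : trapped_swirl ept nxtz (@pred0 unit) (fun _ _ => 0) sg x m.
  split=> //.
  - by apply: zstate_inj; rewrite zstate_walk.
  - move=> i j im jm hij; have := mkseq_uniqP _ _ U i j im jm; apply.
    by rewrite -!zstate_walk /= hij.
exact: proj1 (trapped_swirlP zarc_SD nxtzP ts).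
Qed.

(** A common turning direction leaves no choice: the ends of a hit arc lie on opposite sides, so the
    swirl must continue as [step] does. This makes the enumeration of walks exhaust all swirls. *)
Lemma swirl_walk s : swirl zarc s -> exists sg x,
  is_zcycle sg (zstate x) (size s) /\ s = walk_cycleR sg x (size s).
Proof.
case=> s0 U hit turn.
have hb a : exists b, a \in s -> nxtz a b = next s a.
  have [as_|as_] := boolP (a \in s); last by exists true.
  have [e [f [hef he]]] := hit a as_.
  have [b [eb _]] := ends_ep (fun=> true) hef; exists b => _.
  by rewrite eb in he; rewrite (relint_nxt zarc_SD nxtzP he).
have [beta hbeta] := choice hb.
pose st a := (a, beta a).
have [sg hsg] : exists sg, forall a, a \in s ->
    0 < side ept sg (st a) (front ept (st (next s a))).
  have rl a : a \in s -> in_relint (ept a (beta a)) (zarc (next s a)).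
    by move=> as_; rewrite -hbeta //; apply: nxtzP.
  case: turn => turn; [exists false|exists true] => a as_.
    rewrite /side expr0 mul1r; apply: (turn a as_ _ _ _ (ept (next s a) (~~ beta (next s a))));
      by [apply: ep_ends|apply: rl|apply: rl; rewrite mem_next].
  rewrite /side expr1 mulN1r oppr_gt0.
  apply: (turn a as_ _ _ _ (ept (next s a) (~~ beta (next s a))));
    by [apply: ep_ends|apply: rl|apply: rl; rewrite mem_next].
have hst a : a \in s -> stepR sg (st a) = st (next s a).
  move=> as_; have h1 := hsg a as_.
  have h2 := side_step_front (gram_pos zarc_SD (fun=> true)) (nxt_hit nxtzP)
    (ep_disjoint zarc_SD (up := fun=> true)) sg (st a).
  apply/eqP; rewrite xpair_eqE /= hbeta // eqxx /=.
  apply/negPn/negP => bb; move: h2; rewrite /step /= /front /= hbeta //.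
  set b' := (0 < _) in bb *.
  have -> : b' = ~~ beta (next s a) by move: bb; case: b' (beta (next s a)) => [] [].
  move=> h2; have := side_front ept sg (st a).
  have /(on_arc_ends _ _ (beta (next s a))) [u [v [u0 v0]]] := nxt_hit nxtzP a (beta a).
  rewrite {1}/front /= hbeta // => -> ; rewrite side_linear => h3.
  have : 0 < u * side ept sg (st a) (ept (next s a) (~~ beta (next s a)))
           + v * side ept sg (st a) (ept (next s a) (beta (next s a))).
    by rewrite addr_gt0 // mulr_gt0.
  by rewrite h3 ltxx.
case: s s0 U {hit turn hb} hbeta hsg hst => // x0 s' _ U hbeta hsg hst.
have [E1 E2] := @swirl_traject _ (x0 :: s') x0 U (mem_head _ _).
rewrite [head _ _]/= in E1 E2.
have ms i : iter i (next (x0 :: s')) x0 \in x0 :: s'.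
  by elim: i => [|i IH]; [exact: mem_head|rewrite iterS mem_next].
have hw i : walkR sg (st x0) i = st (iter i (next (x0 :: s')) x0).
  by elim: i => // i IH; rewrite walkS IH hst // iterS.
have Es : x0 :: s' = walk_cycleR sg (st x0) (size s').+1.
  rewrite {1}E1; apply: (@eq_from_nth _ x0); first by rewrite size_traject size_mkseq.
  by move=> i; rewrite size_traject => hi; rewrite nth_traject // nth_mkseq // hw.
exists sg, (st x0); split; last exact: Es.
apply/and3P; split=> //; first by rewrite -zstate_walk hw E2.
by rewrite -zcycle_map -Es map_inj_uniq //; apply: val_inj.
Qed.

Lemma zarc_exactly : check_cycles -> exactly_swirls zarc (size zcycles).
Proof.
case/and3P => /allP hc hp /allP hall.
pose W (c : bool * (nat * bool) * nat) : seq 'I_n.+1 :=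
  walk_cycleR c.1.1 (inord c.1.2.1, c.1.2.2) c.2.
have zst c : c \in zcycles -> zstate (inord c.1.2.1 : 'I_n.+1, c.1.2.2) = c.1.2.
  by move=> /hc /andP[_ h]; rewrite /zstate /= inordK //; case: (c.1.2).
have Wz c : c \in zcycles -> map val (W c) = zcycle_of c.
  by move=> h; rewrite /W zcycle_map zst.
exists (map W zcycles); split; first by rewrite size_map.
- split.
    move=> s /mapP [c hcc ->]; apply: is_zcycle_swirl; rewrite zst //.
    by have /andP[] := hc c hcc.
  rewrite size_map => a b az bz ab [r hr].
  pose c0 := (true, (0, true), 0)%N : bool * (nat * bool) * nat.
  rewrite !(nth_map c0) // in hr.
  set ca := nth c0 _ a in hr; set cb := nth c0 _ b in hr.
  have ha : ca \in zcycles by apply: mem_nth.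
  have hb : cb \in zcycles by apply: mem_nth.
  have pe : perm_eq (zcycle_of ca) (zcycle_of cb).
    by rewrite -!Wz // hr perm_map // perm_sym perm_rot.
  have /(pairwiseP c0) hpw := hp.
  case: (ltngtP a b) => // lt.
    by have := hpw a b az bz lt; rewrite -/ca -/cb pe.
  by have := hpw b a bz az lt; rewrite -/ca -/cb perm_sym pe.
- move=> s hs; have [sg [x [hz Es]]] := swirl_walk hs.
  have us : (size s <= n.+1)%N.
    by case: hs => _ U _ _; rewrite -(card_uniqP U) -[X in (_ <= X)%N]card_ord max_card.
  have := hall sg (mem_bool sg) => /allP/(_ _ (mem_ord x.1))/allP/(_ _ (mem_bool x.2)).
  move=> /allP/(_ (size s)); rewrite mem_iota add0n ltnS us -[(val _, _)]/(zstate x) hz.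
  move=> /(_ isT) /hasP [c cz /hasP [r _ /eqP hr]].
  exists (W c); first exact: map_f.
  exists r; apply: (inj_map val_inj); rewrite map_rot Wz // hr {1}Es.
  exact: zcycle_map.
Qed.

End Example.

(** The vertices of a regular tetrahedron; together with their antipodes they are the vertices of a
    cube. *)
Definition example_poles : seq zvec :=
  [:: (1, 1, 1); (1, -1, -1); (-1, 1, -1); (-1, -1, 1)]%ZZ.

(** Endpoints are integer directions, normalised by [zarc]. Entry [i] of [hits9] names the arcs that
    block the two ends of arc [i], and entry [i] of [types9] its pole; in [cycles9] the flag [true]
    stands for turning right. *)
Definition ends9 : seq (zvec * zvec) :=
  [:: ((-3, 4, 11), (59, -53, -11)); ((71, -55, 57), (-41, 57, -55));
      ((63, 65, -49), (-1, 15, 113)); ((1, -7, -4), (48, -8, 13));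
      ((-55, -41, -57), (25, 32, 24)); ((-5, -4, -3), (5, 7, 9));
      ((-9, -5, -23), (-17, -15, 1)); ((3, -13, -7), (-4, 3, -5));
      ((-3, -1, 1), (1, -5, -3))]%ZZ.
Definition hits9 : seq (nat * nat) :=
  [:: (5, 3); (0, 4); (1, 0); (8, 1); (6, 2); (6, 2); (7, 8); (3, 4); (5, 7)].
Definition types9 : seq nat := [:: 1; 2; 3; 0; 0; 0; 3; 2; 1].
Definition cycles9 : seq (bool * (nat * bool) * nat) :=
  [:: (true, (0, false), 3); (true, (4, false), 3); (false, (0, true), 3);
      (false, (1, true), 3); (false, (3, false), 3); (false, (5, false), 3)].

Definition ends10 : seq (zvec * zvec) :=
  [:: ((-3, -17, -7), (-65, -5, -79)); ((-2, 0, 1), (0, -2, -1));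
      ((-7, 3, -17), (-29, -19, 5)); ((23, -8, 13), (3, 27, -17));
      ((-25, -1, 11), (2, 4, 5)); ((-3, -2, -4), (1, 5, -3));
      ((-9, 19, 33), (19, -9, 5)); ((-3, -7, -5), (7, -1, 3));
      ((5, 29, -19), (-13, -1, 6)); ((19, 1, 29), (-13, 23, -8))]%ZZ.
Definition hits10 : seq (nat * nat) :=
  [:: (1, 2); (4, 7); (5, 1); (6, 8); (8, 9); (0, 3); (4, 7); (0, 3); (5, 1); (6, 8)].
Definition types10 : seq nat := [:: 2; 1; 3; 2; 0; 0; 1; 0; 3; 2].
Definition cycles10 : seq (bool * (nat * bool) * nat) :=
  [:: (true, (0, false), 3); (true, (3, true), 3); (true, (4, true), 3);
      (false, (0, true), 3); (false, (1, false), 3); (false, (3, false), 3)].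

Lemma check_SD9 : check_SD 8 ends9 hits9. Proof. by vm_compute. Qed.
Lemma check_SD10 : check_SD 9 ends10 hits10. Proof. by vm_compute. Qed.
Lemma check_poles_ok : check_poles example_poles. Proof. by vm_compute. Qed.
Lemma check_types9 : check_types 8 ends9 example_poles types9.
Proof. by vm_compute. Qed.
Lemma check_types10 : check_types 9 ends10 example_poles types10.
Proof. by vm_compute. Qed.
Lemma check_one_sided10 : check_one_sided 9 ends10 hits10.
Proof. by vm_compute. Qed.
(* [lazy], here and in [no_bicolouring_seq], because these searches rely on
   short-circuiting boolean connectives. *)
Lemma check_cycles9 : check_cycles 8 ends9 hits9 cycles9.
Proof. by lazy. Qed.
Lemma check_cycles10 : check_cycles 9 ends10 hits10 cycles10.
Proof. by lazy. Qed.

Local Close Scope ring_scope.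

Theorem mainTheorem3 (R : realType) :
  (forall (I : finType) (D : I -> sarc R),
      SD D -> nondeg_oriented D 4 ->
      [/\ at_least_swirls D 6, (9 <= #|I|)%N & (SOD D -> (10 <= #|I|)%N)])
  /\ (exists (I : finType) (D : I -> sarc R),
        [/\ SD D, nondeg_oriented D 4, exactly_swirls D 6 & #|I| = 9%N])
  /\ (exists (I : finType) (D : I -> sarc R),
        [/\ SOD D, nondeg_oriented D 4, exactly_swirls D 6 & #|I| = 10%N]).
Proof.
split; first exact: SD_lower_bounds.
split.
  exists 'I_9, (zarc R (n := 8) ends9); split; last by rewrite card_ord.
  - exact: zarc_SD check_SD9.
  - exact: zarc_oriented check_SD9 check_poles_ok check_types9.
  - exact: zarc_exactly check_SD9 check_cycles9.
exists 'I_10, (zarc R (n := 9) ends10); split; last by rewrite card_ord.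
- exact: zarc_one_sided check_SD10 check_one_sided10.
- exact: zarc_oriented check_SD10 check_poles_ok check_types10.
- exact: zarc_exactly check_SD10 check_cycles10.
Qed.
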